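(* Let $T>0$ and let $B:[0,T]\times\mathbb{T}^2\to\mathbb{R}$ be a scalar field. Suppose that $(v,p)$ is a classical solution on $[0,T]\times\mathbb{T}^2$ to $$\partial_tv+\mathrm{div}_x(v\otimes v)+Bv^{\perp}+\nabla_xp=0,\qquad \mathrm{div}_xv=0,\qquad\int_{\mathbb{T}^2}p(t,x)\,dx=0. \quad(\mathrm{EB})$$ Set $\bar v(t):=\int_{\mathbb{T}^2}v(t,x)\,dx$ and $\omega:=\mathrm{curl}_x(v)=-\mathrm{div}_x(v^{\perp})$. Then $(\omega,v)$ is a classical solution to the system $$\begin{cases}\partial_t\omega+\mathrm{div}_x(v\omega)+\nabla_xB\cdot v=0,\\ \partial_t\bar v=-\int_{\mathbb{T}^2}B(t,x)v^{\perp}(t,x)\,dx,\\ \omega=\Delta_x\psi,\quad v=\bar v(t)+\nabla_x^{\perp}\psi,\quad\int_{\mathbb{T}^2}\psi(t,x)\,dx=0.\end{cases}\quad(\mathrm{W})$$ Conversely, if $(\omega,v)$ is a classical solution to $(\mathrm{W})$, define $$p=(-\Delta_x)^{-1}\big(\mathrm{div}_x\mathrm{div}_x(v\otimes v)+\mathrm{div}_x(Bv^{\perp})\big),\qquad\int_{\mathbb{T}^2}p\,dx=0.$$ Then $(v,p)$ is a classical solution to $(\mathrm{EB})$.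
   Context: $\mathbb{T}^{2}=\mathbb{R}^{2}/\mathbb{Z}^{2}$ (unit area); $u^{\perp}=(-u_2,u_1)$; $\nabla_x^\perp=(-\partial_{x_2},\partial_{x_1})$; the divergence of a matrix field is taken row by row and $(u\otimes v)_{ij}=u_iv_j$. $v$ is $\mathbb{R}^2$-valued, $\omega,p,\psi$ are scalar; in (W), $\bar v(t)$ denotes $\int_{\mathbb{T}^2}v(t,x)\,dx$, and the third line means that there is a $\psi$ with the stated properties. ''Classical solution'' means that all equations hold pointwise with enough regularity for the derivatives involved: concretely, $B$ and $\nabla_xB$ are continuous on $[0,T]\times\mathbb{T}^2$, the functions $v,\omega$ are smooth ($C^\infty$) on $[0,T]\times\mathbb{T}^2$, and $p,\nabla_xp,\nabla_x^2p$ exist and are continuous on $[0,T]\times\mathbb{T}^2$. *)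

(* Defs.v *)
From Stdlib Require Import Reals.
From Coquelicot Require Import Coquelicot.
Open Scope R_scope.

(* Functions on T^2 = R^2/Z^2 are represented by Z^2-periodic functions on R^2.
   A function on [0,T] x T^2 is a function of (t, x) in R x R^2 of which only
   the values at times t in [0,T] are ever constrained or used. *)

Definition periodic (g : R * R -> R) : Prop :=
  forall x : R * R,
    g (fst x + 1, snd x) = g x /\ g (fst x, snd x + 1) = g x.

(* The unit square is a fundamental domain. The iterated Riemann integral is
   only applied to continuous functions. *)
Definition int_T2 (g : R * R -> R) : R :=
  RInt (fun x1 => RInt (fun x2 => g (x1, x2)) 0 1) 0 1.

Definition int_T2_vec (u : R * R -> R * R) : R * R :=
  (int_T2 (fun x => fst (u x)), int_T2 (fun x => snd (u x))).

(** * Space derivatives *)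

Definition d1 (g : R * R -> R) (x : R * R) : R :=
  Derive (fun s => g (s, snd x)) (fst x).
Definition d2 (g : R * R -> R) (x : R * R) : R :=
  Derive (fun s => g (fst x, s)) (snd x).

Definition ex_partials (g : R * R -> R) (x : R * R) : Prop :=
  ex_derive (fun s => g (s, snd x)) (fst x) /\
  ex_derive (fun s => g (fst x, s)) (snd x).

Definition perp (u : R * R) : R * R := (- snd u, fst u).
Definition dot (u w : R * R) : R := fst u * fst w + snd u * snd w.
Definition tensor (u w : R * R) : (R * R) * (R * R) :=
  ((fst u * fst w, fst u * snd w), (snd u * fst w, snd u * snd w)).

Definition grad (g : R * R -> R) (x : R * R) : R * R := (d1 g x, d2 g x).
Definition grad_perp (g : R * R -> R) (x : R * R) : R * R := (- d2 g x, d1 g x).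
Definition div (u : R * R -> R * R) (x : R * R) : R :=
  d1 (fun y => fst (u y)) x + d2 (fun y => snd (u y)) x.
(* A matrix is the pair of its rows. *)
Definition div_mat (M : R * R -> (R * R) * (R * R)) (x : R * R) : R * R :=
  (div (fun y => fst (M y)) x, div (fun y => snd (M y)) x).
Definition curl (u : R * R -> R * R) (x : R * R) : R :=
  - div (fun y => perp (u y)) x.
Definition lap (g : R * R -> R) (x : R * R) : R := div (grad g) x.

(** * Time derivative on [0,T], one-sided at the endpoints *)

Definition is_derive_in (T : R) {V : NormedModule R_AbsRing}
    (f : R -> V) (t : R) (l : V) : Prop :=
  filterdiff f (within (fun s => 0 <= s <= T) (locally t)) (fun h => scal h l).

Definition ex_derive_in (T : R) (f : R -> R) (t : R) : Prop :=
  exists l : R, is_derive_in T f t l.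

Definition Derive_in (T : R) (f : R -> R) (t : R) : R :=
  iota (is_derive_in T f t).

Definition dt (T : R) (f : R -> R * R -> R) (t : R) (x : R * R) : R :=
  Derive_in T (fun s => f s x) t.

Definition dt_vec (T : R) (u : R -> R * R -> R * R) (t : R) (x : R * R) : R * R :=
  (dt T (fun s y => fst (u s y)) t x, dt T (fun s y => snd (u s y)) t x).

(** * Regularity classes *)

Fixpoint Ck (k : nat) (g : R * R -> R) : Prop :=
  (forall x : R * R, continuous g x) /\
  match k with
  | O => True
  | S k' => (forall x : R * R, ex_partials g x) /\ Ck k' (d1 g) /\ Ck k' (d2 g)
  end.

Definition jointly_continuous (T : R) (f : R -> R * R -> R) : Prop :=
  continuous_on (fun z : R * (R * R) => 0 <= fst z <= T)
                (fun z : R * (R * R) => f (fst z) (snd z)).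

(* All space derivatives of order at most k exist and are continuous in (t,x). *)
Fixpoint Ck_space (T : R) (k : nat) (f : R -> R * R -> R) : Prop :=
  jointly_continuous T f /\
  match k with
  | O => True
  | S k' =>
      (forall (t : R) (x : R * R), 0 <= t <= T -> ex_partials (f t) x) /\
      Ck_space T k' (fun t => d1 (f t)) /\
      Ck_space T k' (fun t => d2 (f t))
  end.

(* All derivatives in t, x_1, x_2 of total order at most k exist and are
   continuous in (t,x), up to t = 0 and t = T. *)
Fixpoint Ck_time_space (T : R) (k : nat) (f : R -> R * R -> R) : Prop :=
  jointly_continuous T f /\
  match k with
  | O => True
  | S k' =>
      (forall (t : R) (x : R * R), 0 <= t <= T ->
         ex_derive_in T (fun s => f s x) t /\ ex_partials (f t) x) /\
      Ck_time_space T k' (dt T f) /\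
      Ck_time_space T k' (fun t => d1 (f t)) /\
      Ck_time_space T k' (fun t => d2 (f t))
  end.

Definition periodic_in (T : R) (f : R -> R * R -> R) : Prop :=
  forall t : R, 0 <= t <= T -> periodic (f t).

Definition Ck_space_torus (T : R) (k : nat) (f : R -> R * R -> R) : Prop :=
  periodic_in T f /\ Ck_space T k f.

Definition smooth_torus (T : R) (f : R -> R * R -> R) : Prop :=
  periodic_in T f /\ forall k : nat, Ck_time_space T k f.

Definition smooth_torus_vec (T : R) (u : R -> R * R -> R * R) : Prop :=
  smooth_torus T (fun t x => fst (u t x)) /\
  smooth_torus T (fun t x => snd (u t x)).

(** * The two systems *)

Definition mean_velocity (v : R -> R * R -> R * R) (t : R) : R * R :=
  int_T2_vec (v t).

Record classical_EB (T : R) (B : R -> R * R -> R)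
    (v : R -> R * R -> R * R) (p : R -> R * R -> R) : Prop := {
  EB_B_regular : Ck_space_torus T 1 B;
  EB_v_smooth : smooth_torus_vec T v;
  EB_p_regular : Ck_space_torus T 2 p;
  EB_momentum : forall (t : R) (x : R * R), 0 <= t <= T ->
    plus (plus (plus (dt_vec T v t x)
                     (div_mat (fun y => tensor (v t y) (v t y)) x))
               (scal (B t x) (perp (v t x))))
         (grad (p t) x) = zero;
  EB_div_free : forall (t : R) (x : R * R), 0 <= t <= T -> div (v t) x = 0;
  EB_mean_pressure : forall t : R, 0 <= t <= T -> int_T2 (p t) = 0
}.

(* The regularity required of the stream function psi is that of p; it is
   implied by the smoothness of v, the relation between psi and v and the
   normalisation of the mean of psi. *)
Record classical_W (T : R) (B : R -> R * R -> R)
    (omega : R -> R * R -> R) (v : R -> R * R -> R * R) : Prop := {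
  W_B_regular : Ck_space_torus T 1 B;
  W_omega_smooth : smooth_torus T omega;
  W_v_smooth : smooth_torus_vec T v;
  W_vorticity : forall (t : R) (x : R * R), 0 <= t <= T ->
    dt T omega t x + div (fun y => scal (omega t y) (v t y)) x
      + dot (grad (B t) x) (v t x) = 0;
  W_mean : forall t : R, 0 <= t <= T ->
    is_derive_in T (mean_velocity v) t
      (opp (int_T2_vec (fun x => scal (B t x) (perp (v t x)))));
  W_stream : exists psi : R -> R * R -> R,
    Ck_space_torus T 2 psi /\
    forall t : R, 0 <= t <= T ->
      (forall x : R * R, omega t x = lap (psi t) x) /\
      (forall x : R * R, v t x = plus (mean_velocity v t) (grad_perp (psi t) x)) /\
      int_T2 (psi t) = 0
}.

(* q = (-Delta)^{-1} g on the torus: q is the solution of zero mean of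
   Poisson's equation -Delta q = g. *)
Definition is_inv_neg_lap (g q : R * R -> R) : Prop :=
  periodic q /\ Ck 2 q /\ (forall x : R * R, - lap q x = g x) /\ int_T2 q = 0.

Definition pressure_source (B : R -> R * R -> R) (v : R -> R * R -> R * R)
    (t : R) (x : R * R) : R :=
  div (div_mat (fun y => tensor (v t y) (v t y))) x
    + div (fun y => scal (B t y) (perp (v t y))) x.

(* Main.v *)
(* For a divergence-free [v], (EB) says that the field
   [F = dt v + (v . grad) v + B v^perp] equals [- grad p]. On the torus a C^1
   field is a gradient if and only if its curl and its mean vanish; the curl of
   [F] is the left-hand side of the vorticity equation and the mean of [F] is
   the defect in the equation for the mean of [v], because the advection term is
   a divergence. Potentials, for [v^perp] minus its mean as well as for [F], are
   line integrals along the axes, so Poisson's equation never has to be solved: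
   its right-hand side [div F] is only continuous here. The energy identity
   gives uniqueness for Poisson's equation.

   Functions known on [0,T] only are composed with the projection of R onto
   [0,T]; a one-sided time derivative is then equivalent to an integral
   equation, from which the time derivative is interchanged with the space
   derivatives and with the space integrals. *)
From Stdlib Require Import Reals Lra FunctionalExtensionality ClassicalEpsilon.
From Coquelicot Require Import Coquelicot.
(* Imported last, because Reals also exports a constant [d1]. *)
Require Import Defs.
Open Scope R_scope.

(** * Continuity, parametric integrals and one-sided time derivatives *)

(** The delicate point is dependence on time. In the converse the pressure is prescribed separately
    at each time, so nothing is known beforehand about how it varies with [t]. The potential of [-F]
    is jointly continuous by construction, and uniqueness at each fixed time transfers this to the
    prescribed pressure. That is why uniqueness has to be proved although existence comes from a
    potential.

    (W) states neither [div v = 0] nor [omega = curl v]; both are read off the stream function, the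
    first through the equality of its mixed second derivatives.

    Smoothness in [(t,x)] supplies [d1 (dt T f)] and the time derivative of [d1 (f t)] as continuous
    functions, but its definition does not equate them, and at [t = 0] and [t = T] a two-sided
    Schwarz theorem does not apply. The integral equation in time takes its place. *)

Definition cont {X : UniformSpace} (g : X -> R) : Prop := forall x, continuous g x.

Lemma cont_const (X : UniformSpace) (c : R) : cont (fun _ : X => c).
Proof. intros x; apply continuous_const. Qed.

Lemma cont_plus (X : UniformSpace) (f g : X -> R) :
  cont f -> cont g -> cont (fun x => f x + g x).
Proof. intros Hf Hg x; apply (continuous_plus (V := R_NormedModule) f g x); auto. Qed.

Lemma cont_opp (X : UniformSpace) (f : X -> R) : cont f -> cont (fun x => - f x).
Proof. intros Hf x; apply (continuous_opp (V := R_NormedModule) f x); auto. Qed.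

Lemma cont_minus (X : UniformSpace) (f g : X -> R) :
  cont f -> cont g -> cont (fun x => f x - g x).
Proof. intros Hf Hg x; apply (continuous_minus (V := R_NormedModule) f g x); auto. Qed.

Lemma cont_mult (X : UniformSpace) (f g : X -> R) :
  cont f -> cont g -> cont (fun x => f x * g x).
Proof. intros Hf Hg x; apply (continuous_mult (K := R_AbsRing) f g x); auto. Qed.

Lemma cont_id : cont (fun x : R => x).
Proof. intros x; apply continuous_id. Qed.

Lemma continuous_pair (X U V : UniformSpace) (f : X -> U) (g : X -> V) (x : X) :
  continuous f x -> continuous g x -> continuous (fun y => (f y, g y)) x.
Proof.
  intros Hf Hg; apply continuous_comp_2 with (h := fun u v => (u, v)); auto.
  apply (continuous_ext (fun z => z)); [now intros [u v] | apply continuous_id].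
Qed.

Lemma continuous_snd_comp (X U V : UniformSpace) (f : X -> U * V) (x : X) :
  continuous f x -> continuous (fun x => snd (f x)) x.
Proof.
  intros Hf; apply (continuous_comp f snd); auto.
  destruct (f x); apply continuous_snd.
Qed.

Lemma continuous_fst_comp (X U V : UniformSpace) (f : X -> U * V) (x : X) :
  continuous f x -> continuous (fun x => fst (f x)) x.
Proof.
  intros Hf; apply (continuous_comp f fst); auto.
  destruct (f x); apply continuous_fst.
Qed.

Lemma cont_comp2 (X : UniformSpace) (f : R * R -> R) (u v : X -> R) :
  cont f -> cont u -> cont v -> cont (fun x => f (u x, v x)).
Proof.
  intros Hf Hu Hv x; apply (continuous_comp (fun x => (u x, v x)) f);
    [apply continuous_pair; [apply Hu | apply Hv] | apply Hf].
Qed.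

Lemma cont_comp (X : UniformSpace) (f : R -> R) (u : X -> R) :
  cont f -> cont u -> cont (fun x => f (u x)).
Proof. intros Hf Hu x; apply (continuous_comp u f); [apply Hu | apply Hf]. Qed.

Lemma cont_ext (X : UniformSpace) (f g : X -> R) :
  (forall x, f x = g x) -> cont f -> cont g.
Proof. intros H Hf x; apply (continuous_ext f); auto. Qed.

(** * Projection of the time axis onto [[0,T]] *)

Definition clamp (T t : R) : R := Rmax 0 (Rmin T t).

Lemma clamp_range (T t : R) : 0 < T -> 0 <= clamp T t <= T.
Proof. intros; unfold clamp, Rmax, Rmin; repeat destruct Rle_dec; lra. Qed.

Lemma clamp_id (T t : R) : 0 <= t <= T -> clamp T t = t.
Proof. intros; unfold clamp, Rmax, Rmin; repeat destruct Rle_dec; lra. Qed.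

Lemma clamp_contraction (T s t : R) : Rabs (clamp T s - clamp T t) <= Rabs (s - t).
Proof.
  unfold clamp, Rmax, Rmin; repeat destruct Rle_dec;
    unfold Rabs; repeat destruct Rcase_abs; lra.
Qed.

(** Trades continuity relative to a subset for continuity everywhere, to which the closure rules
    above apply. One direction holds because [clamp] is 1-Lipschitz, the other because it is the
    identity on [[0,T]]. *)
Lemma jointly_continuous_clamp (T : R) (f : R -> R * R -> R) : 0 < T ->
  jointly_continuous T f <->
  cont (fun z : R * (R * R) => f (clamp T (fst z)) (snd z)).
Proof.
  intros HT; split.
  - intros Hf [t x].
    assert (Hc := Hf (clamp T t, x) (clamp_range T t HT)).
    unfold continuous; simpl in Hc |- *.
    revert Hc; apply filterlim_comp with (f := fun z : R * (R * R) => (clamp T (fst z), snd z)).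
    intros P [eps HP]; exists eps; intros [s y] [Hs Hy].
    apply HP; [| now apply clamp_range].
    split; [| exact Hy].
    apply (Rle_lt_trans _ (Rabs (s - t))); [apply clamp_contraction | exact Hs].
  - intros Hf [t x] Ht; simpl in Ht.
    assert (Hc := Hf (t, x)); unfold continuous in Hc; simpl in Hc.
    rewrite clamp_id in Hc by easy.
    simpl; apply filterlim_within_ext with (2 := filterlim_filter_le_1 _ (filter_le_within _) Hc).
    intros [s y] Hs; simpl in *; now rewrite clamp_id.
Qed.

Lemma jointly_continuous_comp (X : UniformSpace) (T : R) (f : R -> R * R -> R)
    (s u v : X -> R) : 0 < T -> jointly_continuous T f ->
  cont s -> cont u -> cont v -> cont (fun z => f (clamp T (s z)) (u z, v z)).
Proof.
  intros HT Hf Hs Hu Hv z; rewrite jointly_continuous_clamp in Hf by easy.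
  apply (continuous_comp (fun z => (s z, (u z, v z)))
    (fun z : R * (R * R) => f (clamp T (fst z)) (snd z))); [| apply Hf].
  repeat apply continuous_pair; [apply Hs | apply Hu | apply Hv].
Qed.

(** The tube lemma: joint continuity gives a neighbourhood around each point [(x, s)], and
    compactness of [[0,1]] gives one radius in [x] that serves every [s]. The tolerance is halved
    because [f y s] and [f x s] are both compared with the value at a common centre [(x, r)]. *)
Lemma continuous_unif_01 (X : UniformSpace) (f : X -> R -> R) (x : X) (eps : posreal) :
  cont (fun z : X * R => f (fst z) (snd z)) ->
  locally x (fun y => forall s, 0 <= s <= 1 -> Rabs (f y s - f x s) < eps).
Proof.
  intros Hf.
  assert (H : forall s : R, exists d : posreal, forall y s', ball x d y ->
    Rabs (s' - s) < d -> Rabs (f y s' - f x s) < pos_div_2 eps).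
  { intros s; destruct (proj1 (filterlim_locally _ _) (Hf (x, s)) (pos_div_2 eps)) as [d Hd].
    exists d; intros y s' Hy Hs; exact (Hd (y, s') (conj Hy Hs)). }
  set (delta s := proj1_sig (constructive_indefinite_description _ (H s))).
  assert (Hdelta : forall s y s', ball x (delta s) y ->
    Rabs (s' - s) < delta s -> Rabs (f y s' - f x s) < pos_div_2 eps).
  { intros s; unfold delta; destruct constructive_indefinite_description; auto. }
  destruct (compactness_value_1d 0 1 delta) as [d Hd].
  exists d; intros y Hy s Hs.
  (* Compactness yields the centre [r] only under a double negation, hence a proof by
     contradiction. *)
  apply Rnot_le_lt; intros Hle; apply (Hd s Hs); intros [r [Hr [Hsr Hdr]]].
  assert (H1 := Hdelta r y s (ball_le _ _ _ Hdr _ Hy) Hsr).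
  assert (H2 := Hdelta r x s (ball_center _ _) Hsr).
  simpl in H1, H2; unfold Rabs in *; repeat destruct Rcase_abs; lra.
Qed.

Lemma cont_ex_RInt (f : R -> R) (a b : R) : cont f -> ex_RInt f a b.
Proof. intros Hf; apply (ex_RInt_continuous (V := R_CompleteNormedModule)); auto. Qed.

Lemma cont_curry (X : UniformSpace) (f : X -> R -> R) (x : X) :
  cont (fun z : X * R => f (fst z) (snd z)) -> cont (f x).
Proof.
  intros Hf s; apply (continuous_comp (fun s => (x, s)) (fun z => f (fst z) (snd z)));
    [| apply Hf].
  apply continuous_pair; [apply continuous_const | apply continuous_id].
Qed.

Lemma cont_RInt_01 (X : UniformSpace) (f : X -> R -> R) :
  cont (fun z : X * R => f (fst z) (snd z)) -> cont (fun x => RInt (f x) 0 1).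
Proof.
  intros Hf x.
  (* The limit theorem asks for uniform convergence on the whole line. Composing with [clamp 1]
     leaves the integral over [[0,1]] unchanged and makes uniformity on [[0,1]] enough. *)
  destruct (filterlim_RInt (V := R_CompleteNormedModule)
    (fun (y : X) (s : R) => f y (clamp 1 s)) 0 1 (locally x) _
    (fun s => f x (clamp 1 s)) (fun y => RInt (f y) 0 1)) as [l [H1 H2]].
  - intros y; apply (is_RInt_ext (f y)).
    + rewrite Rmin_left, Rmax_right by lra; intros s Hs; rewrite clamp_id; lra.
    + apply (RInt_correct (V := R_CompleteNormedModule)), cont_ex_RInt, cont_curry, Hf.
  - apply filterlim_locally; intros eps.
    apply filter_imp with (2 := continuous_unif_01 X f x eps Hf).
    intros y Hy s; apply Hy, clamp_range; lra.
  - unfold continuous; replace (RInt (f x) 0 1) with l; [exact H1 |].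
    rewrite <- (is_RInt_unique _ _ _ _ H2); apply RInt_ext.
    rewrite Rmin_left, Rmax_right by lra; intros s Hs; rewrite clamp_id; lra.
Qed.

(** Moves a variable bound of integration into the integrand, so that integrals with moving
    endpoints fall under the case of the fixed interval [[0,1]]. *)
Lemma RInt_rescale_01 (f : R -> R) (b : R) : cont f ->
  RInt f 0 b = b * RInt (fun s => f (b * s)) 0 1.
Proof.
  intros Hf.
  rewrite <- (RInt_scal (V := R_CompleteNormedModule)).
  - generalize (RInt_comp_lin (V := R_CompleteNormedModule) f b 0 0 1).
    replace (b * 0 + 0) with 0 by ring; replace (b * 1 + 0) with b by ring.
    intros <-; [| now apply cont_ex_RInt].
    apply RInt_ext; intros s _; now rewrite Rplus_0_r.
  - apply cont_ex_RInt, cont_comp; [exact Hf |].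
    apply cont_mult; [apply cont_const | apply cont_id].
Qed.

Lemma cont_RInt_upper (X : UniformSpace) (f : X -> R -> R) (b : X -> R) :
  cont (fun z : X * R => f (fst z) (snd z)) -> cont b ->
  cont (fun x => RInt (f x) 0 (b x)).
Proof.
  intros Hf Hb.
  apply (cont_ext _ (fun x => b x * RInt (fun s => f x (b x * s)) 0 1)).
  { intros x; symmetry; now apply RInt_rescale_01, cont_curry. }
  apply cont_mult; [exact Hb |].
  apply (cont_RInt_01 _ (fun x s => f x (b x * s))); intros z.
  apply (continuous_comp (fun z : X * R => (fst z, b (fst z) * snd z))
    (fun z => f (fst z) (snd z))); [| apply Hf].
  apply continuous_pair.
  - apply continuous_fst_comp, continuous_id.
  - apply (cont_mult _ (fun z : X * R => b (fst z)) (fun z : X * R => snd z)).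
    + intros w; apply (continuous_comp (fun w : X * R => fst w) b);
        [apply continuous_fst_comp, continuous_id | apply Hb].
    + intros w; apply continuous_snd_comp, continuous_id.
Qed.

Lemma is_derive_cont (f g : R -> R) : (forall x, is_derive f x (g x)) -> cont f.
Proof.
  intros H x; apply (ex_derive_continuous (V := R_NormedModule)); eexists; apply H.
Qed.

Lemma is_derive_RInt_upper (f : R -> R) (a b : R) : cont f ->
  is_derive (fun y => RInt f a y) b (f b).
Proof.
  intros Hf; apply (is_derive_RInt f (fun y => RInt f a y) a b); [| apply Hf].
  apply filter_forall; intros y.
  apply (RInt_correct (V := R_CompleteNormedModule)), cont_ex_RInt, Hf.
Qed.

Lemma is_derive_RInt_under (f g : R -> R -> R) (a b x : R) :
  (forall y s, is_derive (fun y => f y s) y (g y s)) ->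
  (forall y, cont (f y)) ->
  cont (fun z : R * R => g (fst z) (snd z)) ->
  is_derive (fun y => RInt (f y) a b) x (RInt (g x) a b).
Proof.
  intros Hd Hf Hg.
  rewrite (RInt_ext (g x) (fun s => Derive (fun y => f y s) x))
    by (intros s _; symmetry; apply is_derive_unique, Hd).
  apply is_derive_RInt_param.
  - apply filter_forall; intros y s _; eexists; apply Hd.
  - intros s _; apply (continuity_2d_pt_ext g).
    + intros u v; symmetry; apply is_derive_unique, Hd.
    + apply continuity_2d_pt_filterlim, Hg.
  - apply filter_forall; intros y; apply cont_ex_RInt, Hf.
Qed.

(** * One-sided time derivatives and the integral equation *)

Lemma is_derive_in_R (T : R) (f : R -> R) (t l : R) : 0 <= t <= T ->
  is_derive_in T f t l <->
  (forall eps : posreal, exists d : posreal, forall s, 0 <= s <= T ->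
     Rabs (s - t) < d -> Rabs (f s - f t - l * (s - t)) <= eps * Rabs (s - t)).
Proof.
  intros Ht; split.
  - intros [_ H] eps.
    assert (Hl : is_filter_lim (within (fun s => 0 <= s <= T) (locally t)) t).
    { intros P HP; apply (filter_le_within (F := locally t)); exact HP. }
    destruct (H t Hl eps) as [d Hd]; exists d; intros s Hs Hst.
    replace (f s - f t - l * (s - t)) with
      (minus (minus (f s) (f t)) (scal (minus s t) l))
      by (unfold minus, plus, opp, scal; simpl; unfold mult; simpl; ring).
    exact (Hd s Hst Hs).
  - intros H; split; [apply (is_linear_scal_l (K := R_AbsRing) (V := R_NormedModule)) |].
    intros x Hx eps.
    (* [filterdiff] quantifies over all limits of the filter. Since [t] itself lies in [[0,T]], it
       belongs to every set of the filter, so [t] is the only limit. *)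
    assert (x = t) as ->.
    { apply cond_eq; intros e He.
      destruct (Hx (fun y => Rabs (y - x) < e)) as [d Hd].
      { exists (mkposreal e He); now intros y Hy. }
      assert (Hb : Rabs (t - x) < e) by (apply (Hd t (ball_center _ _)); easy).
      rewrite Rabs_minus_sym; exact Hb. }
    destruct (H eps) as [d Hd]; exists d; intros s Hst Hs.
    generalize (Hd s Hs Hst).
    replace (f s - f t - l * (s - t)) with
      (minus (minus (f s) (f t)) (scal (minus s t) l))
      by (unfold minus, plus, opp, scal; simpl; unfold mult; simpl; ring).
    easy.
Qed.

Lemma is_derive_in_unique (T : R) (f : R -> R) (t l1 l2 : R) : 0 < T -> 0 <= t <= T ->
  is_derive_in T f t l1 -> is_derive_in T f t l2 -> l1 = l2.
Proof.
  intros HT Ht H1 H2; rewrite is_derive_in_R in H1, H2 by easy.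
  apply cond_eq; intros e He.
  assert (He4 : 0 < e / 4) by lra.
  destruct (H1 (mkposreal _ He4)) as [d1 Hd1]; destruct (H2 (mkposreal _ He4)) as [d2 Hd2].
  simpl in Hd1, Hd2.
  (* A step of length at most [T / 2] stays in [[0,T]] in at least one direction, to the right if
     [t <= T / 2] and to the left otherwise. Halving also makes [h] strictly smaller than both
     radii. *)
  set (h := Rmin (Rmin d1 d2) T / 2).
  assert (Hh : 0 < h /\ h < d1 /\ h < d2 /\ h <= T / 2).
  { generalize (cond_pos d1) (cond_pos d2); unfold h, Rmin; intros.
    repeat destruct Rle_dec; lra. }
  assert (Hs : exists s, 0 <= s <= T /\ Rabs (s - t) = h).
  { destruct (Rle_dec t (T / 2)); [exists (t + h) | exists (t - h)]; split; try lra;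
      unfold Rabs; destruct Rcase_abs; lra. }
  destruct Hs as [s [Hs Hst]].
  specialize (Hd1 s Hs); specialize (Hd2 s Hs); rewrite Hst in Hd1, Hd2.
  assert (Hm : Rabs ((l1 - l2) * (s - t)) <= e / 2 * h).
  { replace ((l1 - l2) * (s - t)) with
      ((f s - f t - l2 * (s - t)) - (f s - f t - l1 * (s - t))) by ring.
    eapply Rle_trans; [apply Rabs_triang |]; rewrite Rabs_Ropp.
    assert (h < d1) by tauto; assert (h < d2) by tauto.
    specialize (Hd1 H); specialize (Hd2 H0); lra. }
  rewrite Rabs_mult, Hst in Hm.
  apply Rmult_le_reg_r in Hm; [lra | tauto].
Qed.

Lemma Derive_in_eq (T : R) (f : R -> R) (t l : R) : 0 < T -> 0 <= t <= T ->
  is_derive_in T f t l -> Derive_in T f t = l.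
Proof.
  intros HT Ht H; apply (iota_unique (V := R_CompleteNormedModule)); [| exact H].
  intros y Hy; exact (is_derive_in_unique T f t y l HT Ht Hy H).
Qed.

Lemma Derive_in_correct (T : R) (f : R -> R) (t : R) : 0 < T -> 0 <= t <= T ->
  ex_derive_in T f t -> is_derive_in T f t (Derive_in T f t).
Proof. intros HT Ht [l Hl]; now rewrite (Derive_in_eq T f t l). Qed.

Lemma is_derive_in_ext (T : R) (f g : R -> R) (t l : R) :
  (forall s, 0 <= s <= T -> f s = g s) -> 0 <= t <= T ->
  is_derive_in T f t l -> is_derive_in T g t l.
Proof.
  intros Hfg Ht; rewrite !is_derive_in_R by easy; intros H eps.
  destruct (H eps) as [d Hd]; exists d; intros s Hs Hst.
  rewrite <- !Hfg by easy; auto.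
Qed.

Lemma is_derive_is_derive_in (T : R) (f : R -> R) (t l : R) :
  is_derive f t l -> 0 <= t <= T -> is_derive_in T f t l.
Proof.
  intros [_ H] Ht; rewrite is_derive_in_R by easy; intros eps.
  destruct (H t (fun P HP => HP) eps) as [d Hd]; exists d; intros s Hs Hst.
  generalize (Hd s Hst).
  replace (f s - f t - l * (s - t)) with
      (minus (minus (f s) (f t)) (scal (minus s t) l))
      by (unfold minus, plus, opp, scal; simpl; unfold mult; simpl; ring).
  easy.
Qed.

Lemma is_derive_in_interior (T : R) (f : R -> R) (t l : R) : 0 < t < T ->
  is_derive_in T f t l -> is_derive f t l.
Proof.
  intros Ht H; rewrite is_derive_in_R in H by lra; split;
    [apply (is_linear_scal_l (K := R_AbsRing) (V := R_NormedModule)) |].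
  intros x Hx eps; rewrite <- (is_filter_lim_locally_unique _ _ Hx).
  destruct (H eps) as [d Hd].
  assert (Hr : 0 < Rmin d (Rmin t (T - t))).
  { generalize (cond_pos d); unfold Rmin; repeat destruct Rle_dec; lra. }
  exists (mkposreal _ Hr); intros s Hs.
  assert (Hs' : Rabs (s - t) < d /\ 0 <= s <= T).
  { change (Rabs (s - t) < Rmin d (Rmin t (T - t))) in Hs.
    revert Hs; unfold Rmin; repeat destruct Rle_dec;
      unfold Rabs; destruct Rcase_abs; lra. }
  generalize (Hd s (proj2 Hs') (proj1 Hs')).
  replace (f s - f t - l * (s - t)) with
      (minus (minus (f s) (f t)) (scal (minus s t) l))
      by (unfold minus, plus, opp, scal; simpl; unfold mult; simpl; ring).
  easy.
Qed.

Lemma is_derive_in_continuous (T : R) (f : R -> R) (t l : R) : 0 <= t <= T ->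
  is_derive_in T f t l -> filterlim f (within (fun s => 0 <= s <= T) (locally t)) (locally (f t)).
Proof.
  intros Ht H; rewrite is_derive_in_R in H by easy.
  apply filterlim_locally; intros eps.
  destruct (H (mkposreal 1 Rlt_0_1)) as [d Hd]; simpl in Hd.
  assert (Hr : 0 < Rmin d (eps / (2 + Rabs l))).
  { apply Rmin_pos; [apply cond_pos |].
    apply Rdiv_lt_0_compat; [apply cond_pos | generalize (Rabs_pos l); lra]. }
  exists (mkposreal _ Hr); intros s Hs Hs'.
  change (Rabs (s - t) < Rmin d (eps / (2 + Rabs l))) in Hs.
  change (Rabs (f s - f t) < eps).
  assert (H1 : Rabs (s - t) < d) by (eapply Rlt_le_trans; [exact Hs | apply Rmin_l]).
  assert (H2 : Rabs (s - t) < eps / (2 + Rabs l))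
    by (eapply Rlt_le_trans; [exact Hs | apply Rmin_r]).
  specialize (Hd s Hs' H1).
  assert (Hl := Rabs_pos l).
  replace (f s - f t) with ((f s - f t - l * (s - t)) + l * (s - t)) by ring.
  eapply Rle_lt_trans; [apply Rabs_triang |]; rewrite Rabs_mult.
  assert (H3 : Rabs (s - t) * (2 + Rabs l) < eps).
  { replace (pos eps) with (eps / (2 + Rabs l) * (2 + Rabs l)) by (field; lra).
    apply Rmult_lt_compat_r; [lra | exact H2]. }
  generalize (Rabs_pos (s - t)); nra.
Qed.

(** The difference of the two sides, extended by [clamp], is continuous on the line and has
    derivative zero inside [(0,T)], so the mean value theorem makes it constant. At the endpoints
    only continuity enters, which a one-sided derivative provides. *)
Lemma is_derive_in_FTC (T : R) (f l : R -> R) : 0 < T ->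
  cont (fun s => l (clamp T s)) ->
  (forall t, 0 <= t <= T -> is_derive_in T f t (l t)) ->
  forall t, 0 <= t <= T -> f t = f 0 + RInt (fun s => l (clamp T s)) 0 t.
Proof.
  intros HT Hl Hf t Ht.
  set (h := fun s => f (clamp T s) - RInt (fun r => l (clamp T r)) 0 s).
  destruct (MVT_gen h 0 t (fun _ => 0)) as [c [_ Hc]].
  - rewrite Rmin_left, Rmax_right by lra; intros s Hs.
    replace 0 with (l s - l (clamp T s)) by (rewrite clamp_id; lra).
    apply (is_derive_minus (V := R_NormedModule)).
    + apply (is_derive_ext_loc f); [| apply (is_derive_in_interior T); [lra | apply Hf; lra]].
      assert (Hr : 0 < Rmin s (T - s)) by (apply Rmin_pos; lra).
      exists (mkposreal _ Hr); intros r Hr'.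
      change (Rabs (r - s) < Rmin s (T - s)) in Hr'.
      symmetry; f_equal; apply clamp_id.
      revert Hr'; unfold Rmin, Rabs; destruct Rle_dec, Rcase_abs; lra.
    + apply (is_derive_RInt_upper (fun r => l (clamp T r))), Hl.
  - intros s _; apply continuity_pt_filterlim.
    apply (cont_minus _ (fun s => f (clamp T s)) (fun s => RInt (fun r => l (clamp T r)) 0 s)).
    + clear -Hf HT; intros s.
      assert (Hc := is_derive_in_continuous T f _ _ (clamp_range T s HT)
        (Hf _ (clamp_range T s HT))).
      revert Hc; apply filterlim_comp.
      intros P [eps HP]; exists eps; intros r Hr; apply HP; [| now apply clamp_range].
      apply (Rle_lt_trans _ (Rabs (r - s))); [apply clamp_contraction | exact Hr].
    + apply (is_derive_cont _ (fun r => l (clamp T r))).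
      intros r; apply (is_derive_RInt_upper (fun r => l (clamp T r)) 0 r Hl).
  - unfold h in Hc; rewrite RInt_point, !clamp_id in Hc by lra.
    unfold zero in Hc; simpl in Hc; lra.
Qed.

(** * Integrals over the torus *)

Ltac cont_leaf := let z := fresh in
  intros z; repeat first [apply continuous_id | apply continuous_fst_comp | apply continuous_snd_comp].

(** Functions of a point of the plane are recognised only when applied to an explicit pair; this is
    why later continuity goals are first put in the form [f (fst x, snd x)]. *)
Ltac cont := match goal with
  | H : cont ?f |- cont ?f => exact H
  | |- cont (fun _ => ?c) => apply cont_const
  | |- cont (fun z => @?a z + @?b z) => apply (cont_plus _ a b); cont
  | |- cont (fun z => @?a z - @?b z) => apply (cont_minus _ a b); cont
  | |- cont (fun z => @?a z * @?b z) => apply (cont_mult _ a b); cont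
  | |- cont (fun z => - @?a z) => apply (cont_opp _ a); cont
  | HT : 0 < ?T, H : jointly_continuous ?T ?f |-
      cont (fun z => ?f (clamp ?T (@?s z)) (@?u z, @?v z)) =>
      apply (jointly_continuous_comp _ T f s u v HT H); cont
  | H : cont ?f |- cont (fun z => ?f (@?u z, @?v z)) => apply (cont_comp2 _ f u v H); cont
  | |- _ => cont_leaf
  end.

Lemma is_derive_is_derive_in_ext (T : R) (F f : R -> R) (t l : R) :
  is_derive F t l -> (forall s, 0 <= s <= T -> F s = f s) -> 0 <= t <= T ->
  is_derive_in T f t l.
Proof.
  intros HF He Ht; apply (is_derive_in_ext T F); auto.
  now apply is_derive_is_derive_in.
Qed.

Lemma is_derive_const_plus (c : R) (f : R -> R) (x l : R) :
  is_derive f x l -> is_derive (fun y => c + f y) x l.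
Proof.
  intros Hf; replace l with (0 + l) by ring.
  apply (is_derive_plus (V := R_NormedModule) (fun _ => c)); [| exact Hf].
  apply (is_derive_const (V := R_NormedModule)).
Qed.

(** The right-hand side of the integral equation makes sense at all times and has a two-sided
    derivative there; restriction to [[0,T]] gives the one-sided one. *)
Lemma is_derive_in_of_FTC (T : R) (f l : R -> R) : cont (fun s => l (clamp T s)) ->
  (forall t, 0 <= t <= T -> f t = f 0 + RInt (fun s => l (clamp T s)) 0 t) ->
  forall t, 0 <= t <= T -> is_derive_in T f t (l t).
Proof.
  intros Hl Hf t Ht.
  apply (is_derive_is_derive_in_ext T (fun s => f 0 + RInt (fun s => l (clamp T s)) 0 s));
    [| intros s Hs; symmetry; auto | auto].
  rewrite <- (clamp_id T t Ht) at 2; apply is_derive_const_plus.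
  apply (is_derive_RInt_upper (fun s => l (clamp T s))), Hl.
Qed.

(** Interchange of a time and a space derivative, up to the endpoints. The integral equation for [f]
    is differentiated in [y] under the integral sign; the result is the integral equation for [fy]
    with integrand [fty], and this is turned back into a time derivative. *)
Lemma is_derive_in_partial (T : R) (f ft fy fty : R -> R -> R) : 0 < T ->
  cont (fun z : R * R => ft (clamp T (fst z)) (snd z)) ->
  cont (fun z : R * R => fty (clamp T (fst z)) (snd z)) ->
  (forall t y, 0 <= t <= T -> is_derive_in T (fun s => f s y) t (ft t y)) ->
  (forall t y, 0 <= t <= T -> is_derive (f t) y (fy t y)) ->
  (forall t y, 0 <= t <= T -> is_derive (ft t) y (fty t y)) ->
  forall t y, 0 <= t <= T -> is_derive_in T (fun s => fy s y) t (fty t y).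
Proof.
  intros HT Cft Cfty Ht Hy Hty t y Htr.
  assert (C1 : forall g : R -> R -> R, cont (fun z : R * R => g (clamp T (fst z)) (snd z)) ->
    forall y, cont (fun s => g (clamp T s) y)).
  { intros g Hg y'; apply (cont_comp2 _ (fun z => g (clamp T (fst z)) (snd z))
      (fun s => s) (fun _ => y')); cont. }
  apply (is_derive_in_of_FTC T (fun s => fy s y) (fun s => fty s y)); auto.
  clear t Htr; intros t Htr.
  assert (H0 : 0 <= 0 <= T) by lra.
  rewrite <- (is_derive_unique _ _ _ (Hy t y Htr)).
  apply is_derive_unique.
  apply (is_derive_ext (fun y => f 0 y + RInt (fun s => ft (clamp T s) y) 0 t)).
  { intros y'; symmetry; apply (is_derive_in_FTC T (fun s => f s y') (fun s => ft s y')); auto. }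
  apply (is_derive_plus (V := R_NormedModule)); [now apply Hy |].
  apply (is_derive_RInt_under (fun y s => ft (clamp T s) y) (fun y s => fty (clamp T s) y)).
  - intros y' s; apply Hty, clamp_range, HT.
  - auto.
  - apply (cont_comp2 _ (fun z => fty (clamp T (fst z)) (snd z)) snd fst); cont.
Qed.

Lemma cont_int_T2 (X : UniformSpace) (g : X -> R * R -> R) :
  cont (fun z : X * (R * R) => g (fst z) (snd z)) -> cont (fun x => int_T2 (g x)).
Proof.
  intros Hg; apply (cont_RInt_01 _ (fun x x1 => RInt (fun x2 => g x (x1, x2)) 0 1)).
  apply (cont_RInt_01 _ (fun (z : X * R) x2 => g (fst z) (snd z, x2))); intros z.
  apply (continuous_comp (fun z : X * R * R => (fst (fst z), (snd (fst z), snd z)))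
    (fun z => g (fst z) (snd z))); [| apply Hg].
  repeat apply continuous_pair;
   repeat first [apply continuous_id | apply continuous_fst_comp | apply continuous_snd_comp].
Qed.

Lemma cont_inner_integral (g : R * R -> R) : cont g ->
  cont (fun x1 => RInt (fun x2 => g (x1, x2)) 0 1).
Proof. intros Hg; apply (cont_RInt_01 _ (fun x1 x2 => g (x1, x2))); cont. Qed.

Lemma cont_slice_snd (g : R * R -> R) (x1 : R) : cont g -> cont (fun x2 => g (x1, x2)).
Proof. intros; cont. Qed.

Lemma int_T2_plus (f g : R * R -> R) : cont f -> cont g ->
  int_T2 (fun x => f x + g x) = int_T2 f + int_T2 g.
Proof.
  intros Hf Hg; unfold int_T2.
  rewrite <- (RInt_plus (V := R_CompleteNormedModule)) by
    now apply cont_ex_RInt, cont_inner_integral.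
  apply RInt_ext; intros x1 _.
  apply (RInt_plus (V := R_CompleteNormedModule)); now apply cont_ex_RInt, cont_slice_snd.
Qed.

Lemma int_T2_opp (f : R * R -> R) : cont f -> int_T2 (fun x => - f x) = - int_T2 f.
Proof.
  intros Hf; unfold int_T2.
  rewrite <- (RInt_opp (V := R_CompleteNormedModule)) by
    now apply cont_ex_RInt, cont_inner_integral.
  apply RInt_ext; intros x1 _.
  apply (RInt_opp (V := R_CompleteNormedModule)); now apply cont_ex_RInt, cont_slice_snd.
Qed.

Lemma int_T2_const (c : R) : int_T2 (fun _ => c) = c.
Proof.
  unfold int_T2; rewrite (RInt_ext _ (fun _ => c)).
  - rewrite RInt_const; unfold scal; simpl; unfold mult; simpl; ring.
  - intros x _; rewrite RInt_const; unfold scal; simpl; unfold mult; simpl; ring.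
Qed.

Lemma is_derive_d1 (g : R * R -> R) (x1 x2 : R) : ex_partials g (x1, x2) ->
  is_derive (fun s => g (s, x2)) x1 (d1 g (x1, x2)).
Proof. intros [H _]; now apply Derive_correct. Qed.

Lemma is_derive_d2 (g : R * R -> R) (x1 x2 : R) : ex_partials g (x1, x2) ->
  is_derive (fun s => g (x1, s)) x2 (d2 g (x1, x2)).
Proof. intros [_ H]; now apply Derive_correct. Qed.

(** The first variable is the outer one in [int_T2], so the derivative is first taken out of the
    inner integral and the fundamental theorem is then applied to the outer one. For [d2] it applies
    directly to the inner integral. *)
Lemma int_T2_d1 (g : R * R -> R) : cont g -> (forall x, ex_partials g x) -> cont (d1 g) ->
  int_T2 (d1 g) = RInt (fun s => g (1, s) - g (0, s)) 0 1.
Proof.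
  intros Hg Hp Hd; unfold int_T2.
  rewrite (is_RInt_unique _ _ _ _ (is_RInt_derive (V := R_CompleteNormedModule)
    (fun x1 => RInt (fun x2 => g (x1, x2)) 0 1) _ 0 1
    (fun x1 _ => is_derive_RInt_under (fun y s => g (y, s)) (fun y s => d1 g (y, s)) 0 1 x1
       (fun y s => is_derive_d1 g y s (Hp (y, s))) (fun y => cont_slice_snd g y Hg)
       ltac:(cont))
    (fun x1 _ => cont_inner_integral _ Hd x1))).
  symmetry; apply (RInt_minus (V := R_CompleteNormedModule));
    now apply cont_ex_RInt, cont_slice_snd.
Qed.

Lemma int_T2_d2 (g : R * R -> R) : (forall x, ex_partials g x) -> cont (d2 g) ->
  int_T2 (d2 g) = RInt (fun s => g (s, 1) - g (s, 0)) 0 1.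
Proof.
  intros Hp Hd; apply RInt_ext; intros x1 _.
  apply is_RInt_unique, (is_RInt_derive (V := R_CompleteNormedModule) (fun x2 => g (x1, x2)));
    intros x2 _.
  - apply is_derive_d2, Hp.
  - now apply (cont_slice_snd (d2 g)).
Qed.

Lemma int_T2_d1_periodic (g : R * R -> R) : periodic g -> cont g ->
  (forall x, ex_partials g x) -> cont (d1 g) -> int_T2 (d1 g) = 0.
Proof.
  intros Hper Hg Hp Hd; rewrite int_T2_d1 by easy.
  rewrite (RInt_ext _ (fun _ => 0)).
  - rewrite RInt_const; unfold scal; simpl; unfold mult; simpl; ring.
  - intros s _; generalize (proj1 (Hper (0, s))); simpl; rewrite Rplus_0_l; lra.
Qed.

Lemma int_T2_d2_periodic (g : R * R -> R) : periodic g ->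
  (forall x, ex_partials g x) -> cont (d2 g) -> int_T2 (d2 g) = 0.
Proof.
  intros Hper Hp Hd; rewrite int_T2_d2 by easy.
  rewrite (RInt_ext _ (fun _ => 0)).
  - rewrite RInt_const; unfold scal; simpl; unfold mult; simpl; ring.
  - intros s _; generalize (proj2 (Hper (s, 0))); simpl; rewrite Rplus_0_l; lra.
Qed.

Lemma is_derive_in_int_T2 (T : R) (f ft : R -> R * R -> R) : 0 < T ->
  jointly_continuous T f -> jointly_continuous T ft ->
  (forall t x, 0 <= t <= T -> is_derive_in T (fun s => f s x) t (ft t x)) ->
  forall t, 0 <= t <= T -> is_derive_in T (fun s => int_T2 (f s)) t (int_T2 (ft t)).
Proof.
  intros HT Hf Hft Hd t Ht.
  (* [F] extends [f] to all times, with a two-sided time derivative. *)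
  set (F := fun t x => f 0 x + RInt (fun s => ft (clamp T s) x) 0 t).
  assert (HF : forall s x, 0 <= s <= T -> F s x = f s x).
  { intros s x Hs; symmetry.
    apply (is_derive_in_FTC T (fun s => f s x) (fun s => ft s x)); auto.
    destruct x; cont. }
  assert (Hc : cont (f 0)).
  { apply (cont_ext _ (fun x : R * R => f (clamp T 0) (fst x, snd x))).
    - intros [x1 x2]; now rewrite clamp_id by lra.
    - cont. }
  assert (HFc : cont (fun z : R * (R * R) => F (fst z) (snd z))).
  { apply cont_plus.
    - apply (cont_ext _ (fun z : R * (R * R) => f 0 (fst (snd z), snd (snd z)))).
      + now intros [s [x1 x2]].
      + cont.
    - apply (cont_RInt_upper _ (fun (z : R * (R * R)) s => ft (clamp T s) (snd z)) fst); [| cont].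
      apply (cont_ext _ (fun z : R * (R * R) * R => ft (clamp T (snd z))
        (fst (snd (fst z)), snd (snd (fst z))))).
      + now intros [[r [x1 x2]] s].
      + cont. }
  assert (HFd : forall s x, is_derive (fun s => F s x) s (ft (clamp T s) x)).
  { intros s x; apply is_derive_const_plus.
    apply (is_derive_RInt_upper (fun s => ft (clamp T s) x)); destruct x; cont. }
  assert (HFc2 : forall s x1, cont (fun x2 => F s (x1, x2))).
  { intros s x1 x2.
    apply (continuous_comp (fun x2 => (s, (x1, x2))) (fun z => F (fst z) (snd z))); [| apply HFc].
    repeat apply continuous_pair; first [apply continuous_const | apply continuous_id]. }
  apply (is_derive_is_derive_in_ext T (fun s => int_T2 (F s))).
  - rewrite <- (clamp_id T t Ht) at 2.
    apply (is_derive_RInt_under (fun s x1 => RInt (fun x2 => F s (x1, x2)) 0 1)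
      (fun s x1 => RInt (fun x2 => ft (clamp T s) (x1, x2)) 0 1)).
    + intros s x1; apply (is_derive_RInt_under (fun s x2 => F s (x1, x2))
        (fun s x2 => ft (clamp T s) (x1, x2))); auto; cont.
    + intros s; apply (cont_RInt_01 _ (fun x1 x2 => F s (x1, x2))).
      intros [x1 x2].
      apply (continuous_comp (fun z : R * R => (s, (fst z, snd z)))
        (fun z : R * (R * R) => F (fst z) (snd z))); [| apply HFc].
      repeat apply continuous_pair;
        first [apply continuous_const | apply continuous_fst | apply continuous_snd].
    + apply (cont_RInt_01 _ (fun (z : R * R) x2 => ft (clamp T (fst z)) (snd z, x2))); cont.
  - intros s Hs; f_equal; apply functional_extensionality; auto.
  - easy.
Qed.

(** * Partial derivatives and potentials *)

(** A relational form that carries existence and values together: with [l1] and [l2] left open, the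
    tactic [partials] below computes them by unification while it proves differentiability. *)
Definition has_partials (g : R * R -> R) (x : R * R) (l1 l2 : R) : Prop :=
  is_derive (fun s => g (s, snd x)) (fst x) l1 /\
  is_derive (fun s => g (fst x, s)) (snd x) l2.

Lemma has_partials_eq (g : R * R -> R) (x : R * R) (l1 l2 : R) :
  has_partials g x l1 l2 -> ex_partials g x /\ d1 g x = l1 /\ d2 g x = l2.
Proof.
  intros [H1 H2]; split; [split; eexists; eassumption |].
  split; now apply is_derive_unique.
Qed.

Lemma ex_partials_correct (g : R * R -> R) (x : R * R) :
  ex_partials g x -> has_partials g x (d1 g x) (d2 g x).
Proof. intros [H1 H2]; split; now apply Derive_correct. Qed.

Lemma has_partials_const (c : R) (x : R * R) : has_partials (fun _ => c) x 0 0.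
Proof. split; apply (is_derive_const (V := R_NormedModule)). Qed.

Lemma has_partials_plus (f g : R * R -> R) (x : R * R) (f1 f2 g1 g2 : R) :
  has_partials f x f1 f2 -> has_partials g x g1 g2 ->
  has_partials (fun y => f y + g y) x (f1 + g1) (f2 + g2).
Proof.
  intros [Hf1 Hf2] [Hg1 Hg2]; split.
  - apply (is_derive_plus (V := R_NormedModule) (fun s => f (s, snd x))); easy.
  - apply (is_derive_plus (V := R_NormedModule) (fun s => f (fst x, s))); easy.
Qed.

Lemma has_partials_opp (f : R * R -> R) (x : R * R) (f1 f2 : R) :
  has_partials f x f1 f2 -> has_partials (fun y => - f y) x (- f1) (- f2).
Proof.
  intros [Hf1 Hf2]; split.
  - apply (is_derive_opp (V := R_NormedModule) (fun s => f (s, snd x))); easy.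
  - apply (is_derive_opp (V := R_NormedModule) (fun s => f (fst x, s))); easy.
Qed.

Lemma has_partials_mult (f g : R * R -> R) (x : R * R) (f1 f2 g1 g2 : R) :
  has_partials f x f1 f2 -> has_partials g x g1 g2 ->
  has_partials (fun y => f y * g y) x (f1 * g x + f x * g1) (f2 * g x + f x * g2).
Proof.
  destruct x as [x1 x2]; intros [Hf1 Hf2] [Hg1 Hg2]; split.
  - apply (is_derive_mult (fun s => f (s, x2)) (fun s => g (s, x2)) x1); try easy.
    intros; apply Rmult_comm.
  - apply (is_derive_mult (fun s => f (x1, s)) (fun s => g (x1, s)) x2); try easy.
    intros; apply Rmult_comm.
Qed.

Ltac partials := match goal with
  | |- has_partials (fun _ => ?c) _ _ _ => apply has_partials_const
  | |- has_partials (fun y => @?a y + @?b y) _ _ _ => apply (has_partials_plus a b); partials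
  | |- has_partials (fun y => @?a y * @?b y) _ _ _ => apply (has_partials_mult a b); partials
  | |- has_partials (fun y => - @?a y) _ _ _ => apply (has_partials_opp a); partials
  | |- has_partials (fun y => ?f y) _ _ _ => apply (ex_partials_correct f); auto
  | |- has_partials ?f _ _ _ => apply (ex_partials_correct f); auto
  end.

Lemma ex_partials_plus (f g : R * R -> R) (x : R * R) :
  ex_partials f x -> ex_partials g x -> ex_partials (fun y => f y + g y) x.
Proof. intros; eapply has_partials_eq; partials. Qed.

Lemma ex_partials_opp (f : R * R -> R) (x : R * R) :
  ex_partials f x -> ex_partials (fun y => - f y) x.
Proof. intros; eapply has_partials_eq; partials. Qed.

Lemma ex_partials_mult (f g : R * R -> R) (x : R * R) :
  ex_partials f x -> ex_partials g x -> ex_partials (fun y => f y * g y) x.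
Proof. intros; eapply has_partials_eq; partials. Qed.

Lemma d1_plus (f g : R * R -> R) (x : R * R) : ex_partials f x -> ex_partials g x ->
  d1 (fun y => f y + g y) x = d1 f x + d1 g x.
Proof. intros; eapply has_partials_eq; partials. Qed.

Lemma d2_plus (f g : R * R -> R) (x : R * R) : ex_partials f x -> ex_partials g x ->
  d2 (fun y => f y + g y) x = d2 f x + d2 g x.
Proof. intros; eapply has_partials_eq; partials. Qed.

Lemma d1_mult (f g : R * R -> R) (x : R * R) : ex_partials f x -> ex_partials g x ->
  d1 (fun y => f y * g y) x = d1 f x * g x + f x * d1 g x.
Proof. intros; eapply has_partials_eq; partials. Qed.

Lemma d2_mult (f g : R * R -> R) (x : R * R) : ex_partials f x -> ex_partials g x ->
  d2 (fun y => f y * g y) x = d2 f x * g x + f x * d2 g x.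
Proof. intros; eapply has_partials_eq; partials. Qed.

(** An equality of functions rather than of values, so that it can be rewritten below a second
    derivative; the total operator [Derive] commutes with negation everywhere. *)
Lemma d1_opp (f : R * R -> R) : d1 (fun y => - f y) = fun x => - d1 f x.
Proof. apply functional_extensionality; intros x; apply (Derive_opp (fun s => f (s, snd x))). Qed.

Lemma d2_opp (f : R * R -> R) : d2 (fun y => - f y) = fun x => - d2 f x.
Proof. apply functional_extensionality; intros x; apply (Derive_opp (fun s => f (fst x, s))). Qed.

(** * Regularity classes in space and their closure properties *)

Lemma Ck_cont (k : nat) (g : R * R -> R) : Ck k g -> cont g.
Proof. destruct k; intros [H _]; exact H. Qed.

Lemma d1_d2_comm (g : R * R -> R) (x : R * R) : Ck 2 g -> d1 (d2 g) x = d2 (d1 g) x.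
Proof.
  intros (_ & Hp & (_ & Hp1 & _ & [C12 _]) & (_ & Hp2 & [C21 _] & _)).
  destruct x as [x1 x2].
  apply (Schwarz (fun u v => g (u, v)) x1 x2).
  - exists posreal_one; intros u v _ _; repeat split.
    + apply (Hp (u, v)).
    + apply (Hp (u, v)).
    + apply (Hp2 (u, v)).
    + apply (Hp1 (u, v)).
  - apply (continuity_2d_pt_filterlim (fun u v => d1 (d2 g) (u, v))).
    apply (cont_ext _ (d1 (d2 g))); [now intros [u v] | exact C21].
  - apply (continuity_2d_pt_filterlim (fun u v => d2 (d1 g) (u, v))).
    apply (cont_ext _ (d2 (d1 g))); [now intros [u v] | exact C12].
Qed.

Lemma jointly_continuous_at (T : R) (f : R -> R * R -> R) (t : R) :
  jointly_continuous T f -> 0 <= t <= T -> cont (f t).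
Proof.
  intros Hf Ht [x1 x2].
  assert (Hc := Hf (t, (x1, x2)) Ht); simpl in Hc.
  revert Hc; apply (filterlim_comp _ _ _ (fun x : R * R => (t, x)) (fun z => f (fst z) (snd z))).
  intros P [eps HP]; exists eps; intros y Hy; apply HP; [| exact Ht].
  split; [apply ball_center | exact Hy].
Qed.

Lemma jointly_continuous_ext (T : R) (f g : R -> R * R -> R) :
  (forall t x, 0 <= t <= T -> f t x = g t x) -> jointly_continuous T f -> jointly_continuous T g.
Proof.
  intros H Hf [t x] Ht; simpl in *; rewrite <- H by easy.
  apply filterlim_within_ext with (2 := Hf (t, x) Ht).
  intros [s y] Hs; now apply H.
Qed.

Lemma Ck_space_jointly_continuous (T : R) (k : nat) (f : R -> R * R -> R) :
  Ck_space T k f -> jointly_continuous T f.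
Proof. destruct k; intros [H _]; exact H. Qed.

Lemma Ck_space_at (T : R) (k : nat) (f : R -> R * R -> R) (t : R) :
  Ck_space T k f -> 0 <= t <= T -> Ck k (f t).
Proof.
  intros H Ht; revert f H; induction k as [| k IH]; intros f H; split.
  - exact (jointly_continuous_at T f t (proj1 H) Ht).
  - easy.
  - exact (jointly_continuous_at T f t (proj1 H) Ht).
  - destruct H as (_ & Hp & H1 & H2); split; [intros x; now apply Hp |].
    split; [exact (IH _ H1) | exact (IH _ H2)].
Qed.

Lemma Ck_space_ext (T : R) (k : nat) (f g : R -> R * R -> R) :
  (forall t x, 0 <= t <= T -> f t x = g t x) -> Ck_space T k f -> Ck_space T k g.
Proof.
  revert f g; induction k as [| k IH]; intros f g H Hf; split;
    try (apply (jointly_continuous_ext T f); [exact H | apply Hf]); [easy |].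
  assert (He : forall t, 0 <= t <= T -> f t = g t)
    by (intros t Ht; apply functional_extensionality; auto).
  destruct Hf as (_ & Hp & H1 & H2); split; [| split].
  - intros; rewrite <- He by easy; now apply Hp.
  - apply (IH (fun t => d1 (f t))); [intros t x Ht; now rewrite He | exact H1].
  - apply (IH (fun t => d2 (f t))); [intros t x Ht; now rewrite He | exact H2].
Qed.

Lemma Ck_space_pred (T : R) (k : nat) (f : R -> R * R -> R) :
  Ck_space T (S k) f -> Ck_space T k f.
Proof.
  revert f; induction k as [| k IH]; intros f (Hf & Hp & H1 & H2); split; try easy.
  split; [exact Hp |]; split; apply IH; easy.
Qed.

Section Joint_continuity.
Context (T : R) (HT : 0 < T).

Lemma jointly_continuous_plus (f g : R -> R * R -> R) :
  jointly_continuous T f -> jointly_continuous T g ->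
  jointly_continuous T (fun t x => f t x + g t x).
Proof. rewrite !jointly_continuous_clamp by easy; apply cont_plus. Qed.

Lemma jointly_continuous_opp (f : R -> R * R -> R) :
  jointly_continuous T f -> jointly_continuous T (fun t x => - f t x).
Proof. rewrite !jointly_continuous_clamp by easy; apply cont_opp. Qed.

Lemma jointly_continuous_mult (f g : R -> R * R -> R) :
  jointly_continuous T f -> jointly_continuous T g ->
  jointly_continuous T (fun t x => f t x * g t x).
Proof. rewrite !jointly_continuous_clamp by easy; apply cont_mult. Qed.

Lemma Ck_space_plus (k : nat) (f g : R -> R * R -> R) :
  Ck_space T k f -> Ck_space T k g -> Ck_space T k (fun t x => f t x + g t x).
Proof.
  revert f g; induction k as [| k IH]; intros f g Hf Hg; split;
    try (apply jointly_continuous_plus; [apply Hf | apply Hg]); [easy |].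
  destruct Hf as (_ & Hfp & Hf1 & Hf2); destruct Hg as (_ & Hgp & Hg1 & Hg2); split; [| split].
  - intros; apply (ex_partials_plus (f t) (g t)); auto.
  - apply (Ck_space_ext T k (fun t x => d1 (f t) x + d1 (g t) x)); [| now apply IH].
    intros t x Ht; symmetry; apply d1_plus; auto.
  - apply (Ck_space_ext T k (fun t x => d2 (f t) x + d2 (g t) x)); [| now apply IH].
    intros t x Ht; symmetry; apply d2_plus; auto.
Qed.

Lemma Ck_space_opp (k : nat) (f : R -> R * R -> R) :
  Ck_space T k f -> Ck_space T k (fun t x => - f t x).
Proof.
  revert f; induction k as [| k IH]; intros f Hf; split;
    try (apply jointly_continuous_opp; apply Hf); [easy |].
  destruct Hf as (_ & Hfp & Hf1 & Hf2); split; [| split].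
  - intros; apply (ex_partials_opp (f t)); auto.
  - apply (Ck_space_ext T k (fun t x => - d1 (f t) x)); [| now apply IH].
    intros t x Ht; now rewrite d1_opp.
  - apply (Ck_space_ext T k (fun t x => - d2 (f t) x)); [| now apply IH].
    intros t x Ht; now rewrite d2_opp.
Qed.

Lemma Ck_space_mult (k : nat) (f g : R -> R * R -> R) :
  Ck_space T k f -> Ck_space T k g -> Ck_space T k (fun t x => f t x * g t x).
Proof.
  revert f g; induction k as [| k IH]; intros f g Hf Hg; split;
    try (apply jointly_continuous_mult; [apply Hf | apply Hg]); [easy |].
  (* In the product rule each derivative is multiplied by an undifferentiated factor, which the
     induction hypothesis needs at order [k]. *)
  assert (Hf' := Ck_space_pred _ _ _ Hf); assert (Hg' := Ck_space_pred _ _ _ Hg).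
  destruct Hf as (_ & Hfp & Hf1 & Hf2); destruct Hg as (_ & Hgp & Hg1 & Hg2); split; [| split].
  - intros; apply (ex_partials_mult (f t) (g t)); auto.
  - apply (Ck_space_ext T k (fun t x => d1 (f t) x * g t x + f t x * d1 (g t) x)).
    + intros t x Ht; symmetry; apply d1_mult; auto.
    + apply Ck_space_plus; now apply IH.
  - apply (Ck_space_ext T k (fun t x => d2 (f t) x * g t x + f t x * d2 (g t) x)).
    + intros t x Ht; symmetry; apply d2_mult; auto.
    + apply Ck_space_plus; now apply IH.
Qed.

(** Needed for spatial means, which are subtracted to normalise fields. All space derivatives
    vanish, so the induction continues with [m = 0]. *)
Lemma Ck_space_time_only (k : nat) (m : R -> R) :
  jointly_continuous T (fun t _ => m t) -> Ck_space T k (fun t _ => m t).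
Proof.
  revert m; induction k as [| k IH]; intros m Hm; split; trivial.
  assert (Hc := fun t x => has_partials_eq _ _ _ _ (has_partials_const (m t) x)).
  assert (H0 : Ck_space T k (fun _ _ => 0)).
  { apply (IH (fun _ => 0)); rewrite jointly_continuous_clamp by easy; apply cont_const. }
  split; [intros; apply Hc |].
  split; apply (Ck_space_ext T k (fun _ _ => 0)); trivial; intros; symmetry; apply Hc.
Qed.

Lemma jointly_continuous_int_T2 (f : R -> R * R -> R) :
  jointly_continuous T f -> jointly_continuous T (fun t _ => int_T2 (f t)).
Proof.
  rewrite !jointly_continuous_clamp by easy; intros Hf.
  intros z; apply (continuous_comp fst (fun t => int_T2 (f (clamp T t)))).
  - destruct z; apply continuous_fst.
  - now apply (cont_int_T2 _ (fun t => f (clamp T t))).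
Qed.

Lemma jointly_continuous_of_cont (f : R -> R * R -> R) :
  cont (fun z : R * (R * R) => f (fst z) (snd z)) -> jointly_continuous T f.
Proof.
  intros Hf [t x] _; apply (filterlim_filter_le_1 _ (filter_le_within _) (Hf (t, x))).
Qed.
End Joint_continuity.

(** * Gradients, periodicity and potentials *)

Lemma zero_partials_const (g : R * R -> R) : (forall x, ex_partials g x) ->
  (forall x, d1 g x = 0) -> (forall x, d2 g x = 0) -> forall x y, g x = g y.
Proof.
  intros Hp H1 H2.
  assert (Hc : forall f : R -> R, (forall s, is_derive f s 0) -> forall a b, f a = f b).
  { intros f Hf a b; destruct (MVT_gen f a b (fun _ => 0)) as [c [_ Hc]]; [auto | | lra].
    intros s _; apply continuity_pt_filterlim, (is_derive_cont f (fun _ => 0)), Hf. }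
  intros [x1 x2] [y1 y2]; transitivity (g (y1, x2)).
  - apply (Hc (fun s => g (s, x2))); intros s; rewrite <- (H1 (s, x2)).
    apply is_derive_d1, Hp.
  - apply (Hc (fun s => g (y1, s))); intros s; rewrite <- (H2 (y1, s)).
    apply is_derive_d2, Hp.
Qed.

Lemma ex_partials_translate (g : R * R -> R) (a b : R) (x : R * R) :
  (forall x, ex_partials g x) ->
  ex_partials (fun y => g (fst y + a, snd y + b)) x /\
  d1 (fun y => g (fst y + a, snd y + b)) x = d1 g (fst x + a, snd x + b) /\
  d2 (fun y => g (fst y + a, snd y + b)) x = d2 g (fst x + a, snd x + b).
Proof.
  intros Hp; destruct x as [x1 x2].
  assert (Hs : forall c s, is_derive (fun s => s + c) s 1).
  { intros c s; auto_derive; [easy | ring]. }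
  apply has_partials_eq; split; simpl.
  - replace (d1 g (x1 + a, x2 + b)) with (scal 1 (d1 g (x1 + a, x2 + b)))
      by (unfold scal; simpl; unfold mult; simpl; ring).
    apply (is_derive_comp (V := R_NormedModule) (fun s => g (s, x2 + b)) (fun s => s + a)); [| apply Hs].
    apply is_derive_d1, Hp.
  - replace (d2 g (x1 + a, x2 + b)) with (scal 1 (d2 g (x1 + a, x2 + b)))
      by (unfold scal; simpl; unfold mult; simpl; ring).
    apply (is_derive_comp (V := R_NormedModule) (fun s => g (x1 + a, s)) (fun s => s + b)); [| apply Hs].
    apply is_derive_d2, Hp.
Qed.

(* The increment of [g] over a period is constant, and equal to the mean of the
   corresponding partial derivative. *)
Lemma periodic_of_gradient (g : R * R -> R) :
  cont g -> (forall x, ex_partials g x) -> cont (d1 g) -> cont (d2 g) ->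
  periodic (d1 g) -> periodic (d2 g) -> int_T2 (d1 g) = 0 -> int_T2 (d2 g) = 0 ->
  periodic g.
Proof.
  intros Hg Hp C1 C2 P1 P2 I1 I2.
  assert (Htr : forall a b, (forall x, d1 g (fst x + a, snd x + b) = d1 g x) ->
    (forall x, d2 g (fst x + a, snd x + b) = d2 g x) ->
    forall x y, g (fst x + a, snd x + b) + - g x = g (fst y + a, snd y + b) + - g y).
  { intros a b H1 H2.
    assert (Ht := fun x => ex_partials_translate g a b x Hp).
    apply (zero_partials_const (fun x => g (fst x + a, snd x + b) + - g x)).
    - intros x; apply (ex_partials_plus _ (fun x => - g x));
        [apply Ht | apply ex_partials_opp, Hp].
    - intros x; rewrite (d1_plus (fun x => g (fst x + a, snd x + b)) (fun x => - g x)).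
      + rewrite (proj1 (proj2 (Ht x))), d1_opp, H1; ring.
      + apply Ht.
      + apply ex_partials_opp, Hp.
    - intros x; rewrite (d2_plus (fun x => g (fst x + a, snd x + b)) (fun x => - g x)).
      + rewrite (proj2 (proj2 (Ht x))), d2_opp, H2; ring.
      + apply Ht.
      + apply ex_partials_opp, Hp. }
  intros [x1 x2]; simpl; split.
  - rewrite int_T2_d1 in I1 by easy.
    rewrite (RInt_ext _ (fun _ => g (x1 + 1, x2) - g (x1, x2))) in I1.
    + rewrite RInt_const in I1; unfold scal in I1; simpl in I1; unfold mult in I1; simpl in I1; lra.
    + intros s _.
      assert (He := Htr 1 0
        (fun x => eq_trans (f_equal (fun r => d1 g (_, r)) (Rplus_0_r _)) (proj1 (P1 x)))
        (fun x => eq_trans (f_equal (fun r => d2 g (_, r)) (Rplus_0_r _)) (proj1 (P2 x)))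
        (0, s) (x1, x2)); simpl in He.
      rewrite !Rplus_0_r, Rplus_0_l in He; lra.
  - rewrite int_T2_d2 in I2 by easy.
    rewrite (RInt_ext _ (fun _ => g (x1, x2 + 1) - g (x1, x2))) in I2.
    + rewrite RInt_const in I2; unfold scal in I2; simpl in I2; unfold mult in I2; simpl in I2; lra.
    + intros s _.
      assert (He := Htr 0 1
        (fun x => eq_trans (f_equal (fun r => d1 g (r, _)) (Rplus_0_r _)) (proj2 (P1 x)))
        (fun x => eq_trans (f_equal (fun r => d2 g (r, _)) (Rplus_0_r _)) (proj2 (P2 x)))
        (s, 0) (x1, x2)); simpl in He.
      rewrite !Rplus_0_r, Rplus_0_l in He; lra.
Qed.

(** The curl condition makes the line integral a potential, the vanishing means make it periodic,
    and subtracting its own mean normalises it. Its regularity needs no separate argument: the first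
    derivatives are [F1] and [F2], of class C^1 in space. *)
Lemma potential_exists (T : R) (F1 F2 : R -> R * R -> R) : 0 < T ->
  Ck_space_torus T 1 F1 -> Ck_space_torus T 1 F2 ->
  (forall t x, 0 <= t <= T -> d1 (F2 t) x = d2 (F1 t) x) ->
  (forall t, 0 <= t <= T -> int_T2 (F1 t) = 0) ->
  (forall t, 0 <= t <= T -> int_T2 (F2 t) = 0) ->
  exists q : R -> R * R -> R, Ck_space_torus T 2 q /\
    forall t, 0 <= t <= T ->
      (forall x, d1 (q t) x = F1 t x) /\ (forall x, d2 (q t) x = F2 t x) /\ int_T2 (q t) = 0.
Proof.
  intros HT [P1 C1] [P2 C2] Hcurl I1 I2.
  assert (J1 := Ck_space_jointly_continuous _ _ _ C1); assert (J2 := Ck_space_jointly_continuous _ _ _ C2).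
  (* The path goes from the origin along the first axis to [(x1, 0)] and then vertically to [x].
     Clamping the time makes [q0] continuous on the whole space, so its restriction to [[0,T]] is
     jointly continuous. *)
  set (q0 := fun (t : R) (x : R * R) => RInt (fun s => F1 (clamp T t) (s, 0)) 0 (fst x)
    + RInt (fun s => F2 (clamp T t) (fst x, s)) 0 (snd x)).
  assert (Hq0c : cont (fun z : R * (R * R) => q0 (fst z) (snd z))).
  { apply cont_plus.
    - apply (cont_RInt_upper _ (fun (z : R * (R * R)) s => F1 (clamp T (fst z)) (s, 0))
        (fun z => fst (snd z))); cont.
    - apply (cont_RInt_upper _ (fun (z : R * (R * R)) s => F2 (clamp T (fst z)) (fst (snd z), s))
        (fun z => snd (snd z))); cont. }
  assert (Hq0d : forall t x, 0 <= t <= T ->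
    ex_partials (q0 t) x /\ d1 (q0 t) x = F1 t x /\ d2 (q0 t) x = F2 t x).
  { intros t [x1 x2] Ht.
    assert (G1 := Ck_space_at _ _ _ _ C1 Ht); assert (G2 := Ck_space_at _ _ _ _ C2 Ht).
    destruct G1 as (G1 & Gp1 & _ & [G12 _]); destruct G2 as (G2 & Gp2 & [G21 _] & _).
    change (cont (F1 t)) in G1; change (cont (F2 t)) in G2.
    change (cont (d2 (F1 t))) in G12; change (cont (d1 (F2 t))) in G21.
    unfold q0; rewrite clamp_id by easy; apply has_partials_eq; split; simpl.
    (* Differentiating the vertical leg in [x1] gives the integral of [d1 (F2 t)]. By the curl
       condition this is the integral of [d2 (F1 t)], that is [F1 t (x1, x2) - F1 t (x1, 0)], and
       the horizontal leg supplies the missing [F1 t (x1, 0)]. *)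
    - replace (F1 t (x1, x2)) with
        (F1 t (x1, 0) + RInt (fun s => d1 (F2 t) (x1, s)) 0 x2).
      + apply (is_derive_plus (V := R_NormedModule)).
        * apply (is_derive_RInt_upper (fun s => F1 t (s, 0))); cont.
        * apply (is_derive_RInt_under (fun y s => F2 t (y, s)) (fun y s => d1 (F2 t) (y, s))).
          -- intros y s; apply is_derive_d1; auto.
          -- intros y; cont.
          -- cont.
      + rewrite (RInt_ext _ (fun s => d2 (F1 t) (x1, s))) by (intros; auto).
        rewrite (is_RInt_unique _ _ _ _ (is_RInt_derive (V := R_CompleteNormedModule)
          (fun s => F1 t (x1, s)) (fun s => d2 (F1 t) (x1, s)) 0 x2
          (fun s _ => is_derive_d2 _ _ _ (Gp1 (x1, s)))
          (fun s _ => cont_slice_snd _ x1 G12 s))).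
        unfold minus, plus, opp; simpl; ring.
    - apply is_derive_const_plus.
      apply (is_derive_RInt_upper (fun s => F2 t (x1, s))); cont. }
  assert (Jq0 := jointly_continuous_of_cont T q0 Hq0c).
  assert (Hm := jointly_continuous_opp T HT _ (jointly_continuous_int_T2 T HT _ Jq0)).
  set (q := fun t x => q0 t x + - int_T2 (q0 t)).
  assert (Hqd : forall t x, 0 <= t <= T ->
    ex_partials (q t) x /\ d1 (q t) x = F1 t x /\ d2 (q t) x = F2 t x).
  { intros t x Ht; destruct (Hq0d t x Ht) as (E & E1 & E2).
    rewrite <- (Rplus_0_r (F1 t x)), <- (Rplus_0_r (F2 t x)), <- E1, <- E2.
    apply has_partials_eq; unfold q; partials. }
  assert (Jq : jointly_continuous T q)
    by exact (jointly_continuous_plus T HT q0 _ Jq0 Hm).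
  exists q; split.
  - split.
    + intros t Ht.
      assert (Hd1 : d1 (q t) = F1 t).
      { apply functional_extensionality; intros x; exact (proj1 (proj2 (Hqd t x Ht))). }
      assert (Hd2 : d2 (q t) = F2 t).
      { apply functional_extensionality; intros x; exact (proj2 (proj2 (Hqd t x Ht))). }
      apply periodic_of_gradient; rewrite ?Hd1, ?Hd2;
        try (now apply (jointly_continuous_at T)); auto.
      intros x; exact (proj1 (Hqd t x Ht)).
    + split; [exact Jq | split; [| split]].
      * intros t x Ht; exact (proj1 (Hqd t x Ht)).
      * apply (Ck_space_ext T 1 F1); [| exact C1].
        intros t x Ht; symmetry; exact (proj1 (proj2 (Hqd t x Ht))).
      * apply (Ck_space_ext T 1 F2); [| exact C2].
        intros t x Ht; symmetry; exact (proj2 (proj2 (Hqd t x Ht))).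
  - intros t Ht; split; [| split].
    + intros x; exact (proj1 (proj2 (Hqd t x Ht))).
    + intros x; exact (proj2 (proj2 (Hqd t x Ht))).
    + assert (Cq := jointly_continuous_at T q0 t Jq0 Ht).
      unfold q; rewrite (int_T2_plus (q0 t) (fun _ => - int_T2 (q0 t)) Cq), int_T2_const;
      [ring | apply cont_const].
Qed.

(** * Uniqueness for Poisson's equation *)

(** A periodic function equals its translate by a period, and differentiation commutes with
    translation. *)
Lemma periodic_partials (g : R * R -> R) : (forall x, ex_partials g x) ->
  periodic g -> periodic (d1 g) /\ periodic (d2 g).
Proof.
  intros Hp Hper.
  assert (H1 : (fun y => g (fst y + 1, snd y + 0)) = g).
  { apply functional_extensionality; intros x; rewrite Rplus_0_r; apply Hper. }
  assert (H2 : (fun y => g (fst y + 0, snd y + 1)) = g).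
  { apply functional_extensionality; intros x; rewrite Rplus_0_r; apply Hper. }
  assert (E1 := fun x => proj2 (ex_partials_translate g 1 0 x Hp)); rewrite H1 in E1.
  assert (E2 := fun x => proj2 (ex_partials_translate g 0 1 x Hp)); rewrite H2 in E2.
  split; intros x; specialize (E1 x); specialize (E2 x); rewrite Rplus_0_r in E1, E2;
    split; symmetry; tauto.
Qed.

Lemma Ck_translate (k : nat) (g : R * R -> R) (a b : R) :
  Ck k g -> Ck k (fun y => g (fst y + a, snd y + b)).
Proof.
  assert (Hc : forall g : R * R -> R, cont g -> cont (fun y => g (fst y + a, snd y + b)))
    by (intros; cont).
  revert g; induction k as [| k IH]; intros g Hg; split;
    try exact (Hc g (Ck_cont _ _ Hg)); trivial.
  destruct Hg as (_ & Hp & H1 & H2).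
  assert (Ht := fun x => ex_partials_translate g a b x Hp).
  split; [apply Ht | split].
  - replace (d1 _) with (fun y => d1 g (fst y + a, snd y + b)); [now apply IH |].
    apply functional_extensionality; intros x; symmetry; apply Ht.
  - replace (d2 _) with (fun y => d2 g (fst y + a, snd y + b)); [now apply IH |].
    apply functional_extensionality; intros x; symmetry; apply Ht.
Qed.

Lemma Ck_minus (k : nat) (f g : R * R -> R) : Ck k f -> Ck k g ->
  Ck k (fun x => f x + - g x).
Proof.
  revert f g; induction k as [| k IH]; intros f g Hf Hg; split;
    try exact (cont_plus _ _ _ (Ck_cont _ _ Hf) (cont_opp _ _ (Ck_cont _ _ Hg))); trivial.
  destruct Hf as (_ & Hfp & Hf1 & Hf2); destruct Hg as (_ & Hgp & Hg1 & Hg2).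
  assert (H : forall x, ex_partials (fun x => f x + - g x) x /\
    d1 (fun x => f x + - g x) x = d1 f x + - d1 g x /\
    d2 (fun x => f x + - g x) x = d2 f x + - d2 g x)
    by (intros x; apply has_partials_eq; partials).
  split; [apply H | split].
  - replace (d1 _) with (fun x => d1 f x + - d1 g x); [now apply IH |].
    apply functional_extensionality; intros x; symmetry; apply H.
  - replace (d2 _) with (fun x => d2 f x + - d2 g x); [now apply IH |].
    apply functional_extensionality; intros x; symmetry; apply H.
Qed.

(** Positivity squeezes the integral over every [[0,y]] to zero, so this integral is locally
    constant in [y]; its derivative at [s] is [f s]. Local constancy needs a neighbourhood of [s]
    inside [[0,1]], hence interior points only. *)
Lemma RInt_0_interior (f : R -> R) : cont f -> (forall s, 0 <= f s) -> RInt f 0 1 = 0 ->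
  forall s, 0 < s < 1 -> f s = 0.
Proof.
  intros Hf Hpos HI s Hs.
  assert (Hz : forall y, 0 <= y <= 1 -> RInt f 0 y = 0).
  { intros y Hy.
    assert (H1 : 0 <= RInt f 0 y) by (apply RInt_ge_0; auto using cont_ex_RInt; lra).
    assert (H2 : 0 <= RInt f y 1) by (apply RInt_ge_0; auto using cont_ex_RInt; lra).
    assert (H3 := RInt_Chasles (V := R_CompleteNormedModule) f 0 y 1
      (cont_ex_RInt f 0 y Hf) (cont_ex_RInt f y 1 Hf)).
    unfold plus in H3; simpl in H3; lra. }
  rewrite <- (is_derive_unique _ _ _ (is_derive_RInt_upper f 0 s Hf)).
  rewrite (Derive_ext_loc _ (fun _ => 0)); [apply Derive_const |].
  assert (Hr : 0 < Rmin s (1 - s)) by (apply Rmin_pos; lra).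
  exists (mkposreal _ Hr); intros r Hr'.
  change (Rabs (r - s) < Rmin s (1 - s)) in Hr'; apply Hz.
  revert Hr'; unfold Rmin, Rabs; destruct Rle_dec, Rcase_abs; lra.
Qed.

Lemma int_T2_0_interior (g : R * R -> R) : cont g -> (forall x, 0 <= g x) ->
  int_T2 g = 0 -> forall x1 x2, 0 < x1 < 1 -> 0 < x2 < 1 -> g (x1, x2) = 0.
Proof.
  intros Hg Hpos HI x1 x2 H1 H2.
  apply (RInt_0_interior (fun s => g (x1, s))); auto; [cont |].
  apply (RInt_0_interior (fun y => RInt (fun s => g (y, s)) 0 1)); auto.
  - now apply cont_inner_integral.
  - intros y; apply RInt_ge_0; auto; [lra |].
    now apply cont_ex_RInt, cont_slice_snd.
Qed.

(** Green's identity: the divergence of [h grad h] is [|grad h|^2 + h lap h], and on the torus a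
    divergence integrates to zero. *)
Lemma harmonic_energy (h : R * R -> R) : periodic h -> Ck 2 h ->
  (forall x, lap h x = 0) ->
  int_T2 (fun x => d1 h x * d1 h x + d2 h x * d2 h x) = 0.
Proof.
  intros Hper (C & Hp & (C1 & Hp1 & [C11 _] & [C12 _]) & (C2 & Hp2 & [C21 _] & [C22 _])) Hlap.
  change (cont h) in C; change (cont (d1 h)) in C1; change (cont (d2 h)) in C2.
  change (cont (d1 (d1 h))) in C11; change (cont (d2 (d2 h))) in C22.
  destruct (periodic_partials h Hp Hper) as [Per1 Per2].
  assert (E1 : d1 (fun x => h x * d1 h x) = fun x => d1 h x * d1 h x + h x * d1 (d1 h) x)
    by (apply functional_extensionality; intros x; now apply d1_mult).
  assert (E2 : d2 (fun x => h x * d2 h x) = fun x => d2 h x * d2 h x + h x * d2 (d2 h) x)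
    by (apply functional_extensionality; intros x; now apply d2_mult).
  assert (I1 : int_T2 (d1 (fun x => h x * d1 h x)) = 0).
  { apply int_T2_d1_periodic.
    - intros x; now rewrite !(proj1 (Hper x)), !(proj2 (Hper x)),
        !(proj1 (Per1 x)), !(proj2 (Per1 x)).
    - now apply cont_mult.
    - intros x; now apply ex_partials_mult.
    - rewrite E1; apply cont_plus; now apply cont_mult. }
  assert (I2 : int_T2 (d2 (fun x => h x * d2 h x)) = 0).
  { apply int_T2_d2_periodic.
    - intros x; now rewrite !(proj1 (Hper x)), !(proj2 (Hper x)),
        !(proj1 (Per2 x)), !(proj2 (Per2 x)).
    - intros x; now apply ex_partials_mult.
    - rewrite E2; apply cont_plus; now apply cont_mult. }
  (* The [0] on the right becomes the sum of the two vanishing integrals, so that it remains to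
     compare integrands. *)
  rewrite <- (Rplus_0_r 0), <- I1 at 1; rewrite <- I2 at 1; rewrite E1, E2.
  rewrite <- int_T2_plus by (apply cont_plus; now apply cont_mult).
  f_equal; apply functional_extensionality; intros x.
  assert (Hx : d1 (d1 h) x + d2 (d2 h) x = 0) by apply Hlap.
  replace (d2 (d2 h) x) with (- d1 (d1 h) x) by lra; ring.
Qed.

(* The gradient is shown to vanish at [(1/2, 1/2)] only; translations do the rest. *)
Lemma harmonic_constant (h : R * R -> R) : periodic h -> Ck 2 h ->
  (forall x, lap h x = 0) -> forall x y, h x = h y.
Proof.
  intros Hper HC Hlap.
  assert (Hp : forall x, ex_partials h x) by apply HC.
  assert (Hp1 : forall x, ex_partials (d1 h) x) by apply HC.
  assert (Hp2 : forall x, ex_partials (d2 h) x) by apply HC.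
  assert (Hgrad : forall x, d1 h x = 0 /\ d2 h x = 0).
  { intros [x1 x2]; set (a := x1 - / 2); set (b := x2 - / 2).
    set (g := fun y : R * R => h (fst y + a, snd y + b)).
    assert (HgC : Ck 2 g) by (apply (Ck_translate 2); exact HC).
    assert (E1 : d1 g = fun y => d1 h (fst y + a, snd y + b)).
    { apply functional_extensionality; intros y; now apply (ex_partials_translate h). }
    assert (E2 : d2 g = fun y => d2 h (fst y + a, snd y + b)).
    { apply functional_extensionality; intros y; now apply (ex_partials_translate h). }
    assert (HI : int_T2 (fun x => d1 g x * d1 g x + d2 g x * d2 g x) = 0).
    { apply harmonic_energy; [| exact HgC |].
      - intros y; unfold g; simpl; split.
        + replace (fst y + 1 + a) with (fst y + a + 1) by ring.
          apply (proj1 (Hper (fst y + a, snd y + b))).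
        + replace (snd y + 1 + b) with (snd y + b + 1) by ring.
          apply (proj2 (Hper (fst y + a, snd y + b))).
      - intros y; change (d1 (d1 g) y + d2 (d2 g) y = 0); rewrite E1, E2.
        rewrite (proj1 (proj2 (ex_partials_translate (d1 h) a b y Hp1))).
        rewrite (proj2 (proj2 (ex_partials_translate (d2 h) a b y Hp2))).
        apply Hlap. }
    assert (H : d1 g (/ 2, / 2) * d1 g (/ 2, / 2) + d2 g (/ 2, / 2) * d2 g (/ 2, / 2) = 0).
    { apply (int_T2_0_interior (fun x => d1 g x * d1 g x + d2 g x * d2 g x)); try lra; auto.
      - destruct HgC as (_ & _ & [C1 _] & [C2 _]).
        apply cont_plus; now apply cont_mult.
      - intros y; generalize (Rle_0_sqr (d1 g y)) (Rle_0_sqr (d2 g y)); unfold Rsqr; lra. }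
    rewrite E1, E2 in H; simpl in H.
    replace (/ 2 + a) with x1 in H by (unfold a; ring).
    replace (/ 2 + b) with x2 in H by (unfold b; ring).
    split; nra. }
  apply zero_partials_const; auto; apply Hgrad.
Qed.

(** The difference of two solutions is harmonic and periodic, hence constant, and its mean is
    zero. *)
Lemma inv_neg_lap_unique (g q1 q2 : R * R -> R) :
  is_inv_neg_lap g q1 -> is_inv_neg_lap g q2 -> q1 = q2.
Proof.
  intros (P1 & C1 & L1 & I1) (P2 & C2 & L2 & I2).
  set (h := fun x => q1 x + - q2 x).
  assert (Hh : forall x, ex_partials q1 x /\ ex_partials q2 x)
    by (intros x; split; [apply C1 | apply C2]).
  assert (E1 : d1 h = fun x => d1 q1 x + - d1 q2 x).
  { apply functional_extensionality; intros x; destruct (Hh x).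
    eapply has_partials_eq; unfold h; partials. }
  assert (E2 : d2 h = fun x => d2 q1 x + - d2 q2 x).
  { apply functional_extensionality; intros x; destruct (Hh x).
    eapply has_partials_eq; unfold h; partials. }
  assert (Hc : forall x y, h x = h y).
  { apply harmonic_constant.
    - intros x; unfold h.
      now rewrite (proj1 (P1 x)), (proj2 (P1 x)), (proj1 (P2 x)), (proj2 (P2 x)).
    - now apply Ck_minus.
    - intros x; change (d1 (d1 h) x + d2 (d2 h) x = 0); rewrite E1, E2.
      destruct C1 as (_ & _ & (_ & Hp11 & _) & (_ & Hp12 & _)).
      destruct C2 as (_ & _ & (_ & Hp21 & _) & (_ & Hp22 & _)).
      rewrite (d1_plus (d1 q1) (fun x => - d1 q2 x)), (d2_plus (d2 q1) (fun x => - d2 q2 x)),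
        d1_opp, d2_opp by auto using ex_partials_opp.
      generalize (L1 x) (L2 x); unfold lap, div, grad; simpl.
      change (fun y => d1 q1 y) with (d1 q1); change (fun y => d1 q2 y) with (d1 q2).
      change (fun y => d2 q1 y) with (d2 q1); change (fun y => d2 q2 y) with (d2 q2).
      lra. }
  assert (I : int_T2 h = 0).
  { assert (Q1 := Ck_cont _ _ C1); assert (Q2 := Ck_cont _ _ C2).
    unfold h; rewrite (int_T2_plus q1 (fun x => - q2 x) Q1 (cont_opp _ _ Q2)).
    rewrite (int_T2_opp q2 Q2), I1, I2; ring. }
  apply functional_extensionality; intros x.
  replace h with (fun _ : R * R => h x) in I
    by (apply functional_extensionality; intros y; apply Hc).
  rewrite int_T2_const in I; unfold h in I; lra.
Qed.

(** * Space-time regularity *)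

Section Time_space.
Context (T : R) (HT : 0 < T).

Lemma is_derive_in_plus (f g : R -> R) (t a b : R) :
  is_derive_in T f t a -> is_derive_in T g t b -> is_derive_in T (fun s => f s + g s) t (a + b).
Proof.
  intros Hf Hg.
  apply (filterdiff_ext_lin (U := R_NormedModule) (V := R_NormedModule) _
    (fun h : R => plus (scal h a) (scal h b))).
  - now apply (filterdiff_plus_fct (U := R_NormedModule) (V := R_NormedModule)).
  - intros h; unfold plus, scal; simpl; unfold mult; simpl; ring.
Qed.

Lemma is_derive_in_opp (f : R -> R) (t a : R) :
  is_derive_in T f t a -> is_derive_in T (fun s => - f s) t (- a).
Proof.
  intros Hf.
  apply (filterdiff_ext_lin (U := R_NormedModule) (V := R_NormedModule) _
    (fun h : R => opp (scal h a))).
  - now apply (filterdiff_opp_fct (U := R_NormedModule) (V := R_NormedModule)).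
  - intros h; unfold opp, scal; simpl; unfold mult; simpl; ring.
Qed.

Lemma is_derive_in_pair (f g : R -> R) (t a b : R) :
  is_derive_in T f t a -> is_derive_in T g t b ->
  is_derive_in T (V := prod_NormedModule _ R_NormedModule R_NormedModule)
    (fun s => (f s, g s)) t (a, b).
Proof.
  intros Hf Hg.
  apply (filterdiff_comp_2 f g (fun u v => (u, v) : prod_NormedModule _ R_NormedModule R_NormedModule)
    (fun h => scal h a) (fun h => scal h b) (fun u v => (u, v))); try easy.
  apply (filterdiff_ext (fun z => z)); [now intros [u v] |].
  apply (filterdiff_ext_lin _ (fun z => z)); [apply filterdiff_id | now intros [u v]].
Qed.

Lemma is_derive_in_components (u : R -> R * R) (t : R) (l : R * R) :
  is_derive_in T (V := prod_NormedModule _ R_NormedModule R_NormedModule) u t l ->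
  is_derive_in T (fun s => fst (u s)) t (fst l) /\ is_derive_in T (fun s => snd (u s)) t (snd l).
Proof.
  intros Hu; split.
  - apply (filterdiff_comp u fst (fun h => scal h l) fst); [exact Hu |].
    apply filterdiff_linear, is_linear_fst.
  - apply (filterdiff_comp u snd (fun h => scal h l) snd); [exact Hu |].
    apply filterdiff_linear, is_linear_snd.
Qed.

Lemma Ck_time_space_jointly_continuous (k : nat) (f : R -> R * R -> R) :
  Ck_time_space T k f -> jointly_continuous T f.
Proof. destruct k; intros [H _]; exact H. Qed.

Lemma is_derive_in_dt (k : nat) (f : R -> R * R -> R) (t : R) (x : R * R) :
  Ck_time_space T (S k) f -> 0 <= t <= T -> is_derive_in T (fun s => f s x) t (dt T f t x).
Proof. intros (_ & Hp & _) Ht; apply Derive_in_correct; [exact HT | exact Ht | now apply Hp]. Qed.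

(** [is_derive_in] sees only times in [[0,T]], and its values are unique there, so agreement on
    [[0,T]] also identifies the time derivatives chosen by [iota]. *)
Lemma Ck_time_space_ext (k : nat) (f g : R -> R * R -> R) :
  (forall t x, 0 <= t <= T -> f t x = g t x) -> Ck_time_space T k f -> Ck_time_space T k g.
Proof.
  revert f g; induction k as [| k IH]; intros f g H Hf; split;
    try exact (jointly_continuous_ext T f g H (Ck_time_space_jointly_continuous _ _ Hf)); trivial.
  assert (He : forall t, 0 <= t <= T -> f t = g t)
    by (intros t Ht; apply functional_extensionality; auto).
  assert (Hd : forall t x, 0 <= t <= T -> is_derive_in T (fun s => g s x) t (dt T f t x)).
  { intros t x Ht; apply (is_derive_in_ext T (fun s => f s x)); auto.
    now apply (is_derive_in_dt k). }
  destruct Hf as (_ & Hp & H0 & H1 & H2); split; [| split; [| split]].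
  - intros t x Ht; split; [eexists; now apply Hd | rewrite <- He by easy; now apply Hp].
  - apply (IH (dt T f)); [| exact H0].
    intros t x Ht; symmetry; apply Derive_in_eq; auto.
  - apply (IH (fun t => d1 (f t))); [intros t x Ht; now rewrite He | exact H1].
  - apply (IH (fun t => d2 (f t))); [intros t x Ht; now rewrite He | exact H2].
Qed.

Lemma Ck_time_space_plus (k : nat) (f g : R -> R * R -> R) :
  Ck_time_space T k f -> Ck_time_space T k g -> Ck_time_space T k (fun t x => f t x + g t x).
Proof.
  revert f g; induction k as [| k IH]; intros f g Hf Hg; split;
    try exact (jointly_continuous_plus T HT f g
      (Ck_time_space_jointly_continuous _ _ Hf) (Ck_time_space_jointly_continuous _ _ Hg)); trivial.
  assert (Hd : forall t x, 0 <= t <= T ->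
    is_derive_in T (fun s => f s x + g s x) t (dt T f t x + dt T g t x)).
  { intros t x Ht; apply is_derive_in_plus; now apply (is_derive_in_dt k). }
  destruct Hf as (_ & Hfp & Hf0 & Hf1 & Hf2); destruct Hg as (_ & Hgp & Hg0 & Hg1 & Hg2).
  split; [| split; [| split]].
  - intros t x Ht; split; [eexists; now apply Hd |].
    apply (ex_partials_plus (f t) (g t)); [now apply Hfp | now apply Hgp].
  - apply (Ck_time_space_ext k (fun t x => dt T f t x + dt T g t x)); [| now apply IH].
    intros t x Ht; symmetry; apply Derive_in_eq; auto.
  - apply (Ck_time_space_ext k (fun t x => d1 (f t) x + d1 (g t) x)); [| now apply IH].
    intros t x Ht; symmetry; apply d1_plus; [now apply Hfp | now apply Hgp].
  - apply (Ck_time_space_ext k (fun t x => d2 (f t) x + d2 (g t) x)); [| now apply IH].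
    intros t x Ht; symmetry; apply d2_plus; [now apply Hfp | now apply Hgp].
Qed.

Lemma Ck_time_space_opp (k : nat) (f : R -> R * R -> R) :
  Ck_time_space T k f -> Ck_time_space T k (fun t x => - f t x).
Proof.
  revert f; induction k as [| k IH]; intros f Hf; split;
    try exact (jointly_continuous_opp T HT f (Ck_time_space_jointly_continuous _ _ Hf)); trivial.
  assert (Hd : forall t x, 0 <= t <= T ->
    is_derive_in T (fun s => - f s x) t (- dt T f t x)).
  { intros t x Ht; apply is_derive_in_opp; now apply (is_derive_in_dt k). }
  destruct Hf as (_ & Hfp & Hf0 & Hf1 & Hf2).
  split; [| split; [| split]].
  - intros t x Ht; split; [eexists; now apply Hd |].
    apply (ex_partials_opp (f t)); now apply Hfp.
  - apply (Ck_time_space_ext k (fun t x => - dt T f t x)); [| now apply IH].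
    intros t x Ht; symmetry; apply Derive_in_eq; auto.
  - apply (Ck_time_space_ext k (fun t x => - d1 (f t) x)); [| now apply IH].
    intros t x Ht; now rewrite d1_opp.
  - apply (Ck_time_space_ext k (fun t x => - d2 (f t) x)); [| now apply IH].
    intros t x Ht; now rewrite d2_opp.
Qed.

Lemma Ck_time_space_Ck_space (k : nat) (f : R -> R * R -> R) :
  Ck_time_space T k f -> Ck_space T k f.
Proof.
  revert f; induction k as [| k IH]; intros f Hf; split;
    try exact (Ck_time_space_jointly_continuous _ _ Hf); trivial.
  destruct Hf as (_ & Hp & _ & H1 & H2); split; [| split; now apply IH].
  intros t x Ht; now apply Hp.
Qed.

(** Order 2 is what makes [d1 (dt T f t)] continuous in [(t,x)], as the interchange requires; the
    other space variable is frozen. *)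
Lemma is_derive_in_d1 (f : R -> R * R -> R) (t : R) (x : R * R) :
  Ck_time_space T 2 f -> 0 <= t <= T ->
  is_derive_in T (fun s => d1 (f s) x) t (d1 (dt T f t) x).
Proof.
  intros (J & Hp & (J0 & Hp0 & _ & [J01 _] & _) & (J1 & _) & _) Ht; destruct x as [x1 x2].
  apply (is_derive_in_partial T (fun t y => f t (y, x2)) (fun t y => dt T f t (y, x2))
    (fun t y => d1 (f t) (y, x2)) (fun t y => d1 (dt T f t) (y, x2))); trivial.
  - cont.
  - apply (jointly_continuous_comp _ T (fun t => d1 (dt T f t)) fst snd (fun _ => x2)); trivial; cont.
  - intros s y Hs; apply Derive_in_correct; [exact HT | exact Hs | now apply Hp].
  - intros s y Hs; apply is_derive_d1; now apply Hp.
  - intros s y Hs; apply is_derive_d1; now apply Hp0.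
Qed.

Lemma is_derive_in_d2 (f : R -> R * R -> R) (t : R) (x : R * R) :
  Ck_time_space T 2 f -> 0 <= t <= T ->
  is_derive_in T (fun s => d2 (f s) x) t (d2 (dt T f t) x).
Proof.
  intros (J & Hp & (J0 & Hp0 & _ & _ & [J02 _]) & _ & (J2 & _)) Ht; destruct x as [x1 x2].
  apply (is_derive_in_partial T (fun t y => f t (x1, y)) (fun t y => dt T f t (x1, y))
    (fun t y => d2 (f t) (x1, y)) (fun t y => d2 (dt T f t) (x1, y))); trivial.
  - cont.
  - apply (jointly_continuous_comp _ T (fun t => d2 (dt T f t)) fst (fun _ => x1) snd); trivial; cont.
  - intros s y Hs; apply Derive_in_correct; [exact HT | exact Hs | now apply Hp].
  - intros s y Hs; apply is_derive_d2; now apply Hp.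
  - intros s y Hs; apply is_derive_d2; now apply Hp0.
Qed.

Lemma smooth_torus_d1 (f : R -> R * R -> R) :
  smooth_torus T f -> smooth_torus T (fun t => d1 (f t)).
Proof.
  intros [P H]; split; [| intros k; apply (H (S k))].
  intros t Ht; apply periodic_partials; [| now apply P].
  intros x; now apply (H 1%nat).
Qed.

Lemma smooth_torus_d2 (f : R -> R * R -> R) :
  smooth_torus T f -> smooth_torus T (fun t => d2 (f t)).
Proof.
  intros [P H]; split; [| intros k; apply (H (S k))].
  intros t Ht; apply periodic_partials; [| now apply P].
  intros x; now apply (H 1%nat).
Qed.

Lemma smooth_torus_dt (f : R -> R * R -> R) :
  smooth_torus T f -> smooth_torus T (dt T f).
Proof.
  intros [P H]; split; [| intros k; apply (H (S k))].
  intros t Ht x; split; apply Derive_in_eq; trivial.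
  - apply (is_derive_in_ext T (fun s => f s x)); trivial.
    + intros s Hs; symmetry; now apply P.
    + now apply (is_derive_in_dt 0 _ _ _ (H 1%nat)).
  - apply (is_derive_in_ext T (fun s => f s x)); trivial.
    + intros s Hs; symmetry; now apply P.
    + now apply (is_derive_in_dt 0 _ _ _ (H 1%nat)).
Qed.

Lemma periodic_in_plus (f g : R -> R * R -> R) :
  periodic_in T f -> periodic_in T g -> periodic_in T (fun t x => f t x + g t x).
Proof.
  intros Hf Hg t Ht x; destruct (Hf t Ht x) as [-> ->]; now destruct (Hg t Ht x) as [-> ->].
Qed.

Lemma periodic_in_mult (f g : R -> R * R -> R) :
  periodic_in T f -> periodic_in T g -> periodic_in T (fun t x => f t x * g t x).
Proof.
  intros Hf Hg t Ht x; destruct (Hf t Ht x) as [-> ->]; now destruct (Hg t Ht x) as [-> ->].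
Qed.

Lemma periodic_in_opp (f : R -> R * R -> R) :
  periodic_in T f -> periodic_in T (fun t x => - f t x).
Proof. intros Hf t Ht x; now destruct (Hf t Ht x) as [-> ->]. Qed.

Lemma smooth_torus_Ck_space_torus (k : nat) (f : R -> R * R -> R) :
  smooth_torus T f -> Ck_space_torus T k f.
Proof. intros [P H]; split; [exact P | apply Ck_time_space_Ck_space, H]. Qed.

Lemma Ck_space_torus_plus (k : nat) (f g : R -> R * R -> R) :
  Ck_space_torus T k f -> Ck_space_torus T k g -> Ck_space_torus T k (fun t x => f t x + g t x).
Proof.
  intros [Pf Cf] [Pg Cg]; split; [now apply periodic_in_plus | now apply Ck_space_plus].
Qed.

Lemma Ck_space_torus_opp (k : nat) (f : R -> R * R -> R) :
  Ck_space_torus T k f -> Ck_space_torus T k (fun t x => - f t x).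
Proof. intros [Pf Cf]; split; [now apply periodic_in_opp | now apply Ck_space_opp]. Qed.

Lemma Ck_space_torus_mult (k : nat) (f g : R -> R * R -> R) :
  Ck_space_torus T k f -> Ck_space_torus T k g -> Ck_space_torus T k (fun t x => f t x * g t x).
Proof.
  intros [Pf Cf] [Pg Cg]; split; [now apply periodic_in_mult | now apply Ck_space_mult].
Qed.
End Time_space.

(** * The force balance *)

(* For a divergence-free [v = (a, b)] the momentum equation reads
   [grad p = - (force1, force2)]. *)
Definition force1 (T : R) (B a b : R -> R * R -> R) (t : R) (x : R * R) : R :=
  dt T a t x + (a t x * d1 (a t) x + b t x * d2 (a t) x) + - (B t x * b t x).

Definition force2 (T : R) (B a b : R -> R * R -> R) (t : R) (x : R * R) : R :=
  dt T b t x + (a t x * d1 (b t) x + b t x * d2 (b t) x) + B t x * a t x.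

Section Flow.
Context (T : R) (HT : 0 < T) (B a b : R -> R * R -> R).
Context (HB : Ck_space_torus T 1 B) (Ha : smooth_torus T a) (Hb : smooth_torus T b).

Local Notation v := (fun (t : R) (x : R * R) => (a t x, b t x)).

Lemma curl_pair (t : R) (x : R * R) : curl (v t) x = d1 (b t) x + - d2 (a t) x.
Proof.
  unfold curl, div, perp; simpl.
  rewrite (d1_opp (fun y => b t y)); change (fun y => a t y) with (a t); 
  change (fun y => b t y) with (b t); ring.
Qed.

Context (Hdiv : forall t x, 0 <= t <= T -> d1 (a t) x + d2 (b t) x = 0).

(** The order is limited by [B]. Order 1 is exactly what [potential_exists] takes, and it returns a
    pressure of order 2. *)
Lemma force_regular :
  Ck_space_torus T 1 (force1 T B a b) /\ Ck_space_torus T 1 (force2 T B a b).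
Proof.
  assert (R := smooth_torus_Ck_space_torus T 1).
  assert (D1 := smooth_torus_d1 T); assert (D2 := smooth_torus_d2 T).
  assert (D0 := smooth_torus_dt T HT).
  split; repeat first [apply (Ck_space_torus_plus T HT 1)
    | apply (Ck_space_torus_opp T HT 1 (fun t x => B t x * b t x))
    | apply (Ck_space_torus_mult T HT 1)]; auto.
Qed.

Section Fixed_time.
Context (t : R) (Ht : 0 <= t <= T).

Lemma smooth_torus_Ck_2 (f : R -> R * R -> R) : smooth_torus T f -> Ck 2 (f t).
Proof. intros Hf; exact (Ck_space_at T 2 f t (proj2 (smooth_torus_Ck_space_torus T 2 f Hf)) Ht). Qed.

Let Ca : Ck 2 (a t) := smooth_torus_Ck_2 a Ha.
Let Cb : Ck 2 (b t) := smooth_torus_Ck_2 b Hb.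
Let Ca' : Ck 2 (dt T a t) := smooth_torus_Ck_2 _ (smooth_torus_dt T HT a Ha).
Let Cb' : Ck 2 (dt T b t) := smooth_torus_Ck_2 _ (smooth_torus_dt T HT b Hb).
Let CB : Ck 1 (B t) := Ck_space_at T 1 B t (proj2 HB) Ht.

Let Pa x : ex_partials (a t) x := proj1 (proj2 Ca) x.
Let Pb x : ex_partials (b t) x := proj1 (proj2 Cb) x.
Let Pa' x : ex_partials (dt T a t) x := proj1 (proj2 Ca') x.
Let Pb' x : ex_partials (dt T b t) x := proj1 (proj2 Cb') x.
Let PB x : ex_partials (B t) x := proj1 (proj2 CB) x.
Let Pa1 x : ex_partials (d1 (a t)) x := proj1 (proj2 (proj1 (proj2 (proj2 Ca)))) x.
Let Pa2 x : ex_partials (d2 (a t)) x := proj1 (proj2 (proj2 (proj2 (proj2 Ca)))) x.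
Let Pb1 x : ex_partials (d1 (b t)) x := proj1 (proj2 (proj1 (proj2 (proj2 Cb)))) x.
Let Pb2 x : ex_partials (d2 (b t)) x := proj1 (proj2 (proj2 (proj2 (proj2 Cb)))) x.

(** Conservative and advective form differ by [v div v], which vanishes. *)
Lemma div_tensor (x : R * R) : div_mat (fun y => tensor (v t y) (v t y)) x =
  (a t x * d1 (a t) x + b t x * d2 (a t) x, a t x * d1 (b t) x + b t x * d2 (b t) x).
Proof.
  assert (H := Hdiv t x Ht).
  unfold div_mat, div, tensor; simpl.
  rewrite (d1_mult (a t) (a t)), (d2_mult (a t) (b t)), (d1_mult (b t) (a t)),
    (d2_mult (b t) (b t)) by auto.
  replace (d2 (b t) x) with (- d1 (a t) x) by lra; f_equal; ring.
Qed.

Lemma momentum_components (p : R * R -> R) (x : R * R) :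
  plus (plus (plus (dt_vec T v t x) (div_mat (fun y => tensor (v t y) (v t y)) x))
             (scal (B t x) (perp (v t x)))) (grad p x) = zero <->
  d1 p x = - force1 T B a b t x /\ d2 p x = - force2 T B a b t x.
Proof.
  rewrite div_tensor.
  unfold dt_vec, perp, grad, force1, force2, plus, scal, zero; simpl.
  unfold prod_plus, prod_scal, prod_zero, plus, scal, zero, dt; simpl; unfold mult; simpl.
  split.
  - intros H; injection H; lra.
  - intros [-> ->]; f_equal; ring.
Qed.

(** Three contributions: the curl of [dt v] is [dt omega] by the interchange of derivatives; the
    curl of [(v . grad) v] is [v . grad omega + omega div v], the divergence of [omega v]; the curl
    of [B v^perp] is [div (B v) = grad B . v + B div v], where the last term is zero. *)
Lemma curl_force (omega : R -> R * R -> R) (x : R * R) :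
  (forall s y, 0 <= s <= T -> omega s y = curl (v s) y) ->
  dt T omega t x + div (fun y => scal (omega t y) (v t y)) x + dot (grad (B t) x) (v t x)
  = d1 (force2 T B a b t) x - d2 (force1 T B a b t) x.
Proof.
  intros Hom.
  assert (Et : dt T omega t x = d1 (dt T b t) x + - d2 (dt T a t) x).
  { apply Derive_in_eq; trivial.
    apply (is_derive_in_ext T (fun s => d1 (b s) x + - d2 (a s) x)); trivial.
    - intros s Hs; now rewrite Hom, curl_pair.
    - apply is_derive_in_plus; [| apply is_derive_in_opp].
      + apply is_derive_in_d1; trivial; apply Hb.
      + apply is_derive_in_d2; trivial; apply Ha. }
  assert (Eo : omega t = fun y => d1 (b t) y + - d2 (a t) y).
  { apply functional_extensionality; intros y; now rewrite Hom, curl_pair. }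
  assert (Ed : div (fun y => scal (omega t y) (v t y)) x =
    d1 (fun y => (d1 (b t) y + - d2 (a t) y) * a t y) x
    + d2 (fun y => (d1 (b t) y + - d2 (a t) y) * b t y) x) by now rewrite Eo.
  assert (F1 : has_partials (fun y => (d1 (b t) y + - d2 (a t) y) * a t y) x _ _) by partials.
  assert (F2 : has_partials (fun y => (d1 (b t) y + - d2 (a t) y) * b t y) x _ _) by partials.
  assert (F3 : has_partials (force1 T B a b t) x _ _) by (unfold force1; partials).
  assert (F4 : has_partials (force2 T B a b t) x _ _) by (unfold force2; partials).
  apply has_partials_eq in F1, F2, F3, F4.
  destruct F1 as (_ & F1 & _), F2 as (_ & _ & F2), F3 as (_ & _ & F3), F4 as (_ & F4 & _).
  rewrite Et, Ed, F1, F2, F3, F4; unfold dot, grad; simpl.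
  rewrite (d1_d2_comm (a t) x Ca), (d1_d2_comm (b t) x Cb).
  assert (H := Hdiv t x Ht).
  replace (d2 (b t) x) with (- d1 (a t) x) by lra; ring.
Qed.

(** The pressure source contains no time derivative because [dt v] is divergence-free: [div v] is
    zero at all times in [[0,T]], and its time derivative is also [div (dt v)], so uniqueness of
    one-sided derivatives applies. *)
Lemma div_force (x : R * R) :
  d1 (force1 T B a b t) x + d2 (force2 T B a b t) x = pressure_source B v t x.
Proof.
  assert (E0 : d1 (dt T a t) x + d2 (dt T b t) x = 0).
  { apply (is_derive_in_unique T (fun s => d1 (a s) x + d2 (b s) x) t); trivial.
    - apply is_derive_in_plus; [apply is_derive_in_d1 | apply is_derive_in_d2]; trivial;
        [apply Ha | apply Hb].
    - apply (is_derive_in_ext T (fun _ => 0)); trivial.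
      + intros s Hs; symmetry; now apply Hdiv.
      + apply is_derive_is_derive_in; trivial; apply (is_derive_const (V := R_NormedModule)). }
  unfold pressure_source.
  rewrite (functional_extensionality _ _ div_tensor).
  assert (Es : div (fun y => scal (B t y) (perp (v t y))) x =
    d1 (fun y => B t y * - b t y) x + d2 (fun y => B t y * a t y) x) by reflexivity.
  rewrite Es; unfold div; simpl.
  assert (F1 : has_partials (force1 T B a b t) x _ _) by (unfold force1; partials).
  assert (F2 : has_partials (force2 T B a b t) x _ _) by (unfold force2; partials).
  assert (F3 : has_partials (fun y => a t y * d1 (a t) y + b t y * d2 (a t) y) x _ _) by partials.
  assert (F4 : has_partials (fun y => a t y * d1 (b t) y + b t y * d2 (b t) y) x _ _) by partials.
  assert (F5 : has_partials (fun y => B t y * - b t y) x _ _) by partials.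
  assert (F6 : has_partials (fun y => B t y * a t y) x _ _) by partials.
  apply has_partials_eq in F1, F2, F3, F4, F5, F6.
  destruct F1 as (_ & -> & _), F2 as (_ & _ & ->), F3 as (_ & -> & _), F4 as (_ & _ & ->),
    F5 as (_ & -> & _), F6 as (_ & _ & ->).
  replace (d1 (dt T a t) x) with (- d2 (dt T b t) x) by lra; ring.
Qed.

(** Since [div v = 0], the integrand is the divergence of the periodic field [f v]. It is used with
    [f] equal to each component of [v]. *)
Lemma int_advection (f : R * R -> R) : Ck 2 f -> periodic f ->
  int_T2 (fun x => a t x * d1 f x + b t x * d2 f x) = 0.
Proof.
  intros Cf Pf.
  assert (Pera : periodic (a t)) by now apply Ha.
  assert (Perb : periodic (b t)) by now apply Hb.
  generalize Ca Cb; intros (Ca0 & _ & [Ca1 _] & _) (Cb0 & _ & _ & [Cb2 _]).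
  destruct Cf as (Cf0 & Pf0 & [Cf1 _] & [Cf2 _]).
  assert (E1 : d1 (fun x => a t x * f x) = fun x => d1 (a t) x * f x + a t x * d1 f x)
    by (apply functional_extensionality; intros x; now apply d1_mult).
  assert (E2 : d2 (fun x => b t x * f x) = fun x => d2 (b t) x * f x + b t x * d2 f x)
    by (apply functional_extensionality; intros x; now apply d2_mult).
  assert (K1 : cont (d1 (fun x => a t x * f x)))
    by (rewrite E1; apply cont_plus; now apply cont_mult).
  assert (K2 : cont (d2 (fun x => b t x * f x)))
    by (rewrite E2; apply cont_plus; now apply cont_mult).
  assert (I1 : int_T2 (d1 (fun x => a t x * f x)) = 0).
  { apply int_T2_d1_periodic; trivial.
    - intros x; destruct (Pera x) as [-> ->]; now destruct (Pf x) as [-> ->].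
    - now apply cont_mult.
    - intros x; now apply ex_partials_mult. }
  assert (I2 : int_T2 (d2 (fun x => b t x * f x)) = 0).
  { apply int_T2_d2_periodic; trivial.
    - intros x; destruct (Perb x) as [-> ->]; now destruct (Pf x) as [-> ->].
    - intros x; now apply ex_partials_mult. }
  rewrite <- (Rplus_0_r 0), <- I1 at 1; rewrite <- I2 at 1.
  rewrite <- int_T2_plus by easy; rewrite E1, E2.
  f_equal; apply functional_extensionality; intros x.
  assert (H := Hdiv t x Ht); replace (d2 (b t) x) with (- d1 (a t) x) by lra; ring.
Qed.

Lemma int_force :
  int_T2 (force1 T B a b t) = int_T2 (dt T a t) + int_T2 (fun x => B t x * - b t x) /\
  int_T2 (force2 T B a b t) = int_T2 (dt T b t) + int_T2 (fun x => B t x * a t x).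
Proof.
  assert (Pera : periodic (a t)) by now apply Ha.
  assert (Perb : periodic (b t)) by now apply Hb.
  assert (Ia := int_advection (a t) Ca Pera); assert (Ib := int_advection (b t) Cb Perb).
  assert (Ka := Ck_cont _ _ Ca); assert (Kb := Ck_cont _ _ Cb); assert (KB := Ck_cont _ _ CB).
  assert (Ka' := Ck_cont _ _ Ca'); assert (Kb' := Ck_cont _ _ Cb').
  generalize Ca Cb; intros (_ & _ & [Ka1 _] & [Ka2 _]) (_ & _ & [Kb1 _] & [Kb2 _]).
  split.
  - replace (force1 T B a b t) with (fun x => dt T a t x
      + (a t x * d1 (a t) x + b t x * d2 (a t) x) + B t x * - b t x)
      by (apply functional_extensionality; intros x; unfold force1; ring).
    rewrite (int_T2_plus (fun x => dt T a t x + (a t x * d1 (a t) x + b t x * d2 (a t) x))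
      (fun x => B t x * - b t x)).
    + rewrite (int_T2_plus (dt T a t)), Ia; [ring | easy |].
      apply cont_plus; now apply cont_mult.
    + apply cont_plus; [easy |]; apply cont_plus; now apply cont_mult.
    + apply cont_mult; [easy | now apply cont_opp].
  - unfold force2.
    rewrite (int_T2_plus (fun x => dt T b t x + (a t x * d1 (b t) x + b t x * d2 (b t) x))
      (fun x => B t x * a t x)).
    + rewrite (int_T2_plus (dt T b t)), Ib; [ring | easy |].
      apply cont_plus; now apply cont_mult.
    + apply cont_plus; [easy |]; apply cont_plus; now apply cont_mult.
    + now apply cont_mult.
Qed.

Lemma is_derive_in_mean (f : R -> R * R -> R) : smooth_torus T f ->
  is_derive_in T (fun s => int_T2 (f s)) t (int_T2 (dt T f t)).
Proof.
  intros Hf; apply (is_derive_in_int_T2 T); trivial.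
  - apply (Ck_time_space_jointly_continuous T 0), Hf.
  - apply (Ck_time_space_jointly_continuous T 0), (smooth_torus_dt T HT f Hf).
  - intros s x Hs; apply (is_derive_in_dt T HT 0); [apply Hf | exact Hs].
Qed.

(** The mean of [v] always has the mean of [dt v] as its derivative. By uniqueness, prescribing that
    derivative is an equation between integrals, and [int_force] shows that its defect is the mean
    of the force. *)
Lemma mean_equation_components :
  is_derive_in T (mean_velocity v) t
    (opp (int_T2_vec (fun x => scal (B t x) (perp (v t x))))) <->
  int_T2 (force1 T B a b t) = 0 /\ int_T2 (force2 T B a b t) = 0.
Proof.
  destruct int_force as [-> ->].
  assert (Da := is_derive_in_mean a Ha); assert (Db := is_derive_in_mean b Hb).
  split.
  - intros H; apply is_derive_in_components in H; destruct H as [H1 H2].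
    apply (is_derive_in_unique T _ t _ _ HT Ht Da) in H1.
    apply (is_derive_in_unique T _ t _ _ HT Ht Db) in H2.
    rewrite H1, H2; split; apply Rplus_opp_l.
  - intros [H1 H2].
    assert (E : opp (int_T2_vec (fun x => scal (B t x) (perp (v t x))))
      = (int_T2 (dt T a t), int_T2 (dt T b t))).
    { transitivity (- int_T2 (fun x => B t x * - b t x), - int_T2 (fun x => B t x * a t x));
        [reflexivity | f_equal; lra]. }
    rewrite E; exact (is_derive_in_pair T _ _ t _ _ Da Db).
Qed.
End Fixed_time.
End Flow.

(** * Equivalence of the two systems *)

Section Equivalence.
Context (T : R) (HT : 0 < T) (B a b : R -> R * R -> R).
Local Notation v := (fun (t : R) (x : R * R) => (a t x, b t x)).

Lemma smooth_torus_curl : smooth_torus T a -> smooth_torus T b ->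
  smooth_torus T (fun t x => curl (v t) x).
Proof.
  intros Ha Hb.
  assert (E : (fun t x => d1 (b t) x + - d2 (a t) x) = (fun t x => curl (v t) x)).
  { apply functional_extensionality; intros t; apply functional_extensionality; intros x.
    symmetry; apply curl_pair. }
  refine (eq_ind _ (smooth_torus T) _ _ E).
  destruct (smooth_torus_d1 T b Hb) as [P1 C1], (smooth_torus_d2 T a Ha) as [P2 C2].
  split.
  - apply periodic_in_plus; [exact P1 | now apply periodic_in_opp].
  - intros k; apply Ck_time_space_plus; auto; now apply Ck_time_space_opp.
Qed.

(** The equation for [v] prescribes the gradient of [psi] as [(b - mean b, - (a - mean a))]. The
    curl of this field is [div v], so incompressibility is the condition for a potential. *)
Lemma stream_function_exists : smooth_torus T a -> smooth_torus T b ->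
  (forall t x, 0 <= t <= T -> d1 (a t) x + d2 (b t) x = 0) ->
  exists psi : R -> R * R -> R, Ck_space_torus T 2 psi /\
    forall t, 0 <= t <= T ->
      (forall x, curl (v t) x = lap (psi t) x) /\
      (forall x, v t x = plus (mean_velocity v t) (grad_perp (psi t) x)) /\
      int_T2 (psi t) = 0.
Proof.
  intros Ha Hb Hdiv.
  (* Zero mean is what makes the potential periodic; subtracting a function of time alone leaves the
     space derivatives unchanged. *)
  assert (Hmean : forall f, smooth_torus T f ->
    Ck_space_torus T 1 (fun t x => f t x + - int_T2 (f t)) /\
    forall t, 0 <= t <= T -> int_T2 (fun x => f t x + - int_T2 (f t)) = 0 /\
      forall x, d1 (fun x => f t x + - int_T2 (f t)) x = d1 (f t) x /\
        d2 (fun x => f t x + - int_T2 (f t)) x = d2 (f t) x).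
  { intros f Hf; assert (Jf := Ck_time_space_jointly_continuous T 0 f (proj2 Hf 0%nat)); split.
    - apply Ck_space_torus_plus; [exact HT | now apply smooth_torus_Ck_space_torus |].
      split; [now intros t Ht x |].
      now apply Ck_space_time_only, jointly_continuous_opp, jointly_continuous_int_T2.
    - intros t Ht; split.
      + rewrite (int_T2_plus (f t) (fun _ => - int_T2 (f t))), int_T2_const; [ring | |].
        * now apply (jointly_continuous_at T).
        * apply cont_const.
      + intros x; rewrite <- (Rplus_0_r (d1 (f t) x)), <- (Rplus_0_r (d2 (f t) x)).
        assert (Hx : ex_partials (f t) x) by (apply (proj2 Hf 1%nat); exact Ht).
        apply has_partials_eq; partials. }
  destruct (Hmean a Ha) as [Ra Ea], (Hmean b Hb) as [Rb Eb].
  destruct (potential_exists T (fun t x => b t x + - int_T2 (b t))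
    (fun t x => - (a t x + - int_T2 (a t)))) as [psi [Hpsi Hq]]; trivial.
  - now apply Ck_space_torus_opp.
  - intros t x Ht; rewrite (d1_opp (fun x => a t x + - int_T2 (a t))).
    destruct (Ea t Ht) as [_ Ea'], (Eb t Ht) as [_ Eb'].
    rewrite (proj1 (Ea' x)), (proj2 (Eb' x)); generalize (Hdiv t x Ht); lra.
  - intros t Ht; now apply Eb.
  - intros t Ht; rewrite (int_T2_opp (fun x => a t x + - int_T2 (a t))).
    + rewrite (proj1 (Ea t Ht)); ring.
    + exact (jointly_continuous_at T _ t (Ck_space_jointly_continuous _ _ _ (proj2 Ra)) Ht).
  - exists psi; split; [exact Hpsi |]; intros t Ht.
    destruct (Hq t Ht) as (H1 & H2 & H3).
    destruct (Ea t Ht) as [_ Ea'], (Eb t Ht) as [_ Eb']; split; [| split; trivial].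
    + intros x; rewrite curl_pair.
      change (lap (psi t) x) with (d1 (d1 (psi t)) x + d2 (d2 (psi t)) x).
      rewrite (functional_extensionality _ _ H1), (functional_extensionality _ _ H2).
      rewrite (d2_opp (fun x => a t x + - int_T2 (a t))).
      now rewrite (proj1 (Eb' x)), (proj2 (Ea' x)).
    + intros x; unfold grad_perp; rewrite H1, H2.
      change (mean_velocity v t) with (int_T2 (a t), int_T2 (b t)).
      unfold plus; simpl; unfold prod_plus, plus; simpl; f_equal; ring.
Qed.

(** The force is [- grad p]. Its curl vanishes by symmetry of second derivatives, since [p] is C^2,
    and its mean vanishes by periodicity of [p]; these are the vorticity and the mean equation. *)
Lemma EB_implies_W (p : R -> R * R -> R) :
  classical_EB T B v p -> classical_W T B (fun t x => curl (v t) x) v.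
Proof.
  intros [HB [Ha Hb] Hp Hmom Hdiv Hpm]; simpl in Ha, Hb.
  change (smooth_torus T a) in Ha; change (smooth_torus T b) in Hb.
  change (forall t x, 0 <= t <= T -> d1 (a t) x + d2 (b t) x = 0) in Hdiv.
  assert (Hgrad : forall t x, 0 <= t <= T ->
    d1 (p t) x = - force1 T B a b t x /\ d2 (p t) x = - force2 T B a b t x).
  { intros t x Ht; apply momentum_components; auto. }
  assert (Hg1 : forall t, 0 <= t <= T -> d1 (p t) = fun x => - force1 T B a b t x)
    by (intros t Ht; apply functional_extensionality; intros x; now apply Hgrad).
  assert (Hg2 : forall t, 0 <= t <= T -> d2 (p t) = fun x => - force2 T B a b t x)
    by (intros t Ht; apply functional_extensionality; intros x; now apply Hgrad).
  assert (HpC : forall t, 0 <= t <= T -> Ck 2 (p t))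
    by (intros t Ht; exact (Ck_space_at T 2 p t (proj2 Hp) Ht)).
  destruct (force_regular T HT B a b HB Ha Hb) as [[_ F1] [_ F2]].
  split; trivial.
  - now apply smooth_torus_curl.
  - split; assumption.
  - intros t x Ht.
    rewrite (curl_force T HT B a b HB Ha Hb Hdiv t Ht (fun t x => curl (v t) x)) by trivial.
    assert (H := d1_d2_comm (p t) x (HpC t Ht)).
    rewrite Hg1, Hg2, (d1_opp (force2 T B a b t)), (d2_opp (force1 T B a b t)) in H by easy.
    lra.
  - intros t Ht; apply (mean_equation_components T HT B a b HB Ha Hb Hdiv t Ht).
    assert (Cp := HpC t Ht); destruct Cp as (Cp & Pp & [Cp1 _] & [Cp2 _]).
    assert (Pert : periodic (p t)) by now apply Hp.
    assert (K1 := jointly_continuous_at T _ t (Ck_space_jointly_continuous _ _ _ F1) Ht).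
    assert (K2 := jointly_continuous_at T _ t (Ck_space_jointly_continuous _ _ _ F2) Ht).
    assert (I1 := int_T2_d1_periodic (p t) Pert Cp Pp Cp1).
    assert (I2 := int_T2_d2_periodic (p t) Pert Pp Cp2).
    rewrite Hg1, (int_T2_opp (force1 T B a b t)) in I1 by easy.
    rewrite Hg2, (int_T2_opp (force2 T B a b t)) in I2 by easy.
    lra.
  - now apply stream_function_exists.
Qed.

(** Up to a constant in space, [v] is [(- d2 psi, d1 psi)]: its divergence is a difference of mixed
    derivatives and its curl is [lap psi]. *)
Lemma W_incompressible (omega : R -> R * R -> R) : classical_W T B omega v ->
  forall t x, 0 <= t <= T ->
    d1 (a t) x + d2 (b t) x = 0 /\ omega t x = curl (v t) x.
Proof.
  intros [_ _ _ _ _ [psi [Hpsi HW]]] t x Ht.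
  destruct (HW t Ht) as (Hlap & Hv & _).
  assert (C := Ck_space_at T 2 psi t (proj2 Hpsi) Ht).
  assert (H12 := d1_d2_comm _ x C).
  destruct C as (_ & _ & (_ & P1 & _) & (_ & P2 & _)).
  assert (Ea : a t = fun y => int_T2 (a t) + - d2 (psi t) y).
  { apply functional_extensionality; intros y; exact (f_equal fst (Hv y)). }
  assert (Eb : b t = fun y => int_T2 (b t) + d1 (psi t) y).
  { apply functional_extensionality; intros y; exact (f_equal snd (Hv y)). }
  assert (Fa : has_partials (fun y => int_T2 (a t) + - d2 (psi t) y) x _ _) by partials.
  assert (Fb : has_partials (fun y => int_T2 (b t) + d1 (psi t) y) x _ _) by partials.
  rewrite <- Ea in Fa; rewrite <- Eb in Fb.
  apply has_partials_eq in Fa, Fb; destruct Fa as (_ & A1 & A2), Fb as (_ & B1 & B2).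
  rewrite Hlap, curl_pair, A1, A2, B1, B2.
  change (lap (psi t) x) with (d1 (d1 (psi t)) x + d2 (d2 (psi t)) x).
  split; lra.
Qed.

(** The vorticity equation and the mean equation are the two conditions for [-F] to have a periodic
    potential. Taking the divergence of [grad q = - F] then gives Poisson's equation with the
    required source. *)
Lemma pressure_exists (omega : R -> R * R -> R) : classical_W T B omega v ->
  exists q : R -> R * R -> R, Ck_space_torus T 2 q /\
    forall t, 0 <= t <= T ->
      (forall x, d1 (q t) x = - force1 T B a b t x) /\
      (forall x, d2 (q t) x = - force2 T B a b t x) /\
      is_inv_neg_lap (pressure_source B v t) (q t).
Proof.
  intros HW; assert (Hinc := W_incompressible omega HW).
  destruct HW as [HB _ [Ha Hb] Hvort Hmean _].
  change (smooth_torus T a) in Ha; change (smooth_torus T b) in Hb.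
  assert (Hdiv : forall t x, 0 <= t <= T -> d1 (a t) x + d2 (b t) x = 0)
    by (intros; now apply Hinc).
  destruct (force_regular T HT B a b HB Ha Hb) as [F1 F2].
  assert (Hint : forall t, 0 <= t <= T ->
    int_T2 (force1 T B a b t) = 0 /\ int_T2 (force2 T B a b t) = 0).
  { intros t Ht; apply (mean_equation_components T HT B a b HB Ha Hb Hdiv t Ht); auto. }
  destruct (potential_exists T (fun t x => - force1 T B a b t x)
    (fun t x => - force2 T B a b t x)) as [q [Hq Hgrad]]; trivial.
  - now apply Ck_space_torus_opp.
  - now apply Ck_space_torus_opp.
  - intros t x Ht; rewrite (d1_opp (force2 T B a b t)), (d2_opp (force1 T B a b t)).
    assert (H := Hvort t x Ht).
    rewrite (curl_force T HT B a b HB Ha Hb Hdiv t Ht omega) in H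
      by (intros; now apply Hinc).
    lra.
  - intros t Ht; rewrite (int_T2_opp (force1 T B a b t)).
    + rewrite (proj1 (Hint t Ht)); ring.
    + exact (jointly_continuous_at T _ t (Ck_space_jointly_continuous _ _ _ (proj2 F1)) Ht).
  - intros t Ht; rewrite (int_T2_opp (force2 T B a b t)).
    + rewrite (proj2 (Hint t Ht)); ring.
    + exact (jointly_continuous_at T _ t (Ck_space_jointly_continuous _ _ _ (proj2 F2)) Ht).
  - exists q; split; [exact Hq |]; intros t Ht.
    destruct (Hgrad t Ht) as (H1 & H2 & H3); split; [exact H1 | split; [exact H2 |]].
    split; [now apply Hq | split; [exact (Ck_space_at T 2 q t (proj2 Hq) Ht) | split]].
    + intros x; rewrite <- (div_force T HT B a b HB Ha Hb Hdiv t Ht).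
      change (lap (q t) x) with (d1 (d1 (q t)) x + d2 (d2 (q t)) x).
      rewrite (functional_extensionality _ _ H1), (functional_extensionality _ _ H2).
      rewrite (d1_opp (force1 T B a b t)), (d2_opp (force2 T B a b t)); ring.
    + exact H3.
Qed.

(** At each time [p] coincides with the potential [q] by uniqueness; from [q] it receives its
    gradient and its joint continuity in [(t,x)]. *)
Lemma W_implies_EB (omega p : R -> R * R -> R) : classical_W T B omega v ->
  (forall t, 0 <= t <= T -> is_inv_neg_lap (pressure_source B v t) (p t)) ->
  classical_EB T B v p.
Proof.
  intros HW Hp; assert (Hinc := W_incompressible omega HW).
  destruct (pressure_exists omega HW) as [q [Hq Hgrad]].
  destruct HW as [HB _ [Ha Hb] _ _ _].
  change (smooth_torus T a) in Ha; change (smooth_torus T b) in Hb.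
  assert (Hdiv : forall t x, 0 <= t <= T -> d1 (a t) x + d2 (b t) x = 0)
    by (intros; now apply Hinc).
  assert (Heq : forall t, 0 <= t <= T -> p t = q t)
    by (intros t Ht; apply (inv_neg_lap_unique (pressure_source B v t));
        [auto | now apply Hgrad]).
  split; trivial.
  - split; assumption.
  - split; [intros t Ht; now apply Hp |].
    apply (Ck_space_ext T 2 q); [| apply Hq].
    intros t x Ht; now rewrite Heq.
  - intros t x Ht; apply momentum_components; trivial.
    rewrite Heq by easy; split; now apply Hgrad.
  - intros t Ht; now apply Hp.
Qed.
End Equivalence.

Theorem lemma3p2 (T : R) (HT : 0 < T) (B : R -> R * R -> R) :
  (forall (v : R -> R * R -> R * R) (p : R -> R * R -> R),
     classical_EB T B v p ->
     classical_W T B (fun t x => curl (v t) x) v)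
  /\
  (forall (omega : R -> R * R -> R) (v : R -> R * R -> R * R),
     classical_W T B omega v ->
     (* (-Delta)^{-1} is well defined on the right-hand side *)
     (forall t : R, 0 <= t <= T ->
        exists! q : R * R -> R, is_inv_neg_lap (pressure_source B v t) q)
     /\
     (forall p : R -> R * R -> R,
        (forall t : R, 0 <= t <= T ->
           is_inv_neg_lap (pressure_source B v t) (p t)) ->
        classical_EB T B v p)).
Proof.
  (* The preceding lemmas take the velocity as a pair of scalar fields; by extensionality every [v]
     is literally of this form. *)
  assert (Hpair : forall v : R -> R * R -> R * R, exists a b,
    v = fun t x => (a t x, b t x)).
  { intros v; exists (fun t x => fst (v t x)), (fun t x => snd (v t x)).
    apply functional_extensionality; intros t; apply functional_extensionality; intros x.
    apply surjective_pairing. }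
  split.
  - intros v p; destruct (Hpair v) as (a & b & ->); now apply EB_implies_W.
  - intros omega v; destruct (Hpair v) as (a & b & ->); intros HW; split.
    + intros t Ht; destruct (pressure_exists T HT B a b omega HW) as [q [_ Hq]].
      exists (q t); split; [now apply Hq |].
      intros q' Hq'; apply (inv_neg_lap_unique (pressure_source B (fun t x => (a t x, b t x)) t));
        [now apply Hq | exact Hq'].
    + intros p; now apply (W_implies_EB T HT B a b omega).
Qed.
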